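(* Let $Q_1,Q_2\subset\mathbb{R}^2$ be convex tiles with $(Q_1-Q_1)\cap\mathbb{Z}^2\subseteq (Q_2-Q_2)\cap\mathbb{Z}^2$. Then $$(1-\lambda)Q_1+\lambda Q_2+\mathbb{Z}^2=\mathbb{R}^2\quad\text{for all }\lambda\in[0,1].$$ Moreover, for any $\lambda\in[0,1]$ and $\mu\in[0,1)$, the body $\mu\big((1-\lambda)Q_1+\lambda Q_2\big)$ is not covering.
   Context: A convex body is a non-empty compact convex set. A convex tile $Q\subset\mathbb{R}^2$ is a convex body with $Q+\mathbb{Z}^2=\mathbb{R}^2$ whose translates $Q+z$, $z\in\mathbb{Z}^2$, have pairwise disjoint interiors. A convex body $K\subset\mathbb{R}^2$ is covering if $K+\mathbb{Z}^2=\mathbb{R}^2$. For sets $A,B$, $A+B=\{a+b: a\in A, b\in B\}$ and $A-B=\{a-b: a\in A,b\in B\}$. *)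

(* Defs.v *)
From HB Require Import structures.
From mathcomp Require Import all_boot all_order all_algebra.
From mathcomp Require Import all_classical all_reals all_analysis.
Import Order.TTheory GRing.Theory Num.Theory.
Import numFieldNormedType.Exports.

Set Implicit Arguments.
Unset Strict Implicit.
Unset Printing Implicit Defensive.

Local Open Scope classical_set_scope.
Local Open Scope ring_scope.

Definition minkowski_sum (V : zmodType) (A B : set V) : set V :=
  [set a + b | a in A & b in B].

Definition minkowski_diff (V : zmodType) (A B : set V) : set V :=
  [set a - b | a in A & b in B].

Definition dilate (R : realType) (V : lmodType R) (c : R) (A : set V) : set V :=
  [set c *: a | a in A].

Definition Z2 (R : realType) : set 'rV[R]_2 :=
  [set map_mx intr z | z in [set: 'rV[int]_2]].
Arguments Z2 : clear implicits.

Definition convex_body (R : realType) (K : set 'rV[R]_2) : Prop :=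
  [/\ K !=set0, compact K & convex_set K].

Definition covering (R : realType) (K : set 'rV[R]_2) : Prop :=
  minkowski_sum K (Z2 R) = setT.

Definition translate (R : realType) (Q : set 'rV[R]_2) (z : 'rV[int]_2) :
    set 'rV[R]_2 :=
  [set q + map_mx intr z | q in Q].

Definition convex_tile (R : realType) (Q : set 'rV[R]_2) : Prop :=
  [/\ convex_body Q, covering Q
    & trivIset [set: 'rV[int]_2] (fun z => interior (translate Q z))].

(* Main.v *)
Require Import Defs.
From HB Require Import structures.
From mathcomp Require Import all_boot all_order all_algebra.
From mathcomp Require Import all_classical all_reals all_analysis.
From mathcomp Require Import zify ring lra.
Import Order.TTheory GRing.Theory Num.Theory.
Import numFieldNormedType.Exports.

Local Open Scope classical_set_scope.
Local Open Scope ring_scope.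

(** If p is a point where three translates Q, Q + u, Q + v of a convex tile meet, then u, v
    is a basis of Z^2; in the coordinates of this basis with origin p, the packing
    condition confines Q to the triangle -1 <= x, -1 <= y, x + y <= 0, which has no lattice
    point in its interior.  By covering, Q + u, Q + v, Q + u + v also have a common point
    p + d, with d in the triangle conv(0, u, v), so Q contains a hexagon determined by p
    and d.  The condition on d is linear: if two tiles admit the same basis, their convex
    combination contains the hexagon of the combined p and d, which covers, and lies in a
    translate of the lattice-free triangle, so no smaller dilate covers.  The inclusion of
    the difference sets provides the common basis, because u, v and u - v being
    neighbours of 0 in the second tiling forces a triple point of Q2, Q2 + u, Q2 + v. *)

(** * Planar convex sets in coordinates *)

(** Planar sets are encoded as predicates of two coordinates, so that membership goals reduce to
    linear arithmetic on the coordinates. *)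
Definition convex2 {R : realType} (F : R -> R -> Prop) : Prop :=
  forall x y x' y' t, F x y -> F x' y' -> 0 <= t <= 1 ->
    F ((1 - t) * x + t * x') ((1 - t) * y + t * y').

Definition diff2 {R : realType} (F : R -> R -> Prop) (x y : R) : Prop :=
  exists a b a' b', [/\ F a b, F a' b', x = a - a' & y = b - b'].

(** The packing condition in difference-set form: for a convex F with interior points, [t z] lies in
    F - F for some t > 1 exactly when z is interior to F - F, that is, when F and F + z overlap. *)
Definition no_stretched_lattice {R : realType} (F : R -> R -> Prop) : Prop :=
  forall (m n : int) (t : R), 1 < t -> diff2 F (t * m%:~R) (t * n%:~R) ->
    m = 0 /\ n = 0.

Lemma pred2_eq (T : Type) (F : T -> T -> Prop) (x y x' y' : T) :
  F x y -> x = x' -> y = y' -> F x' y'.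
Proof. by move=> Fxy <- <-. Qed.

Lemma convex2_eq (R : realType) (F : R -> R -> Prop) (t a b a' b' x y : R) :
  convex2 F -> F a b -> F a' b' -> 0 <= t <= 1 ->
  x = (1 - t) * a + t * a' -> y = (1 - t) * b + t * b' -> F x y.
Proof. by move=> cF Fa Fb ht -> ->; apply: cF. Qed.

Lemma convex2_three (R : realType) (F : R -> R -> Prop)
    (r s t a b a' b' a'' b'' x y : R) :
  convex2 F -> F a b -> F a' b' -> F a'' b'' ->
  0 <= r -> 0 <= s -> 0 <= t -> r + s + t = 1 ->
  x = r * a + s * a' + t * a'' -> y = r * b + s * b' + t * b'' -> F x y.
Proof.
move=> cF Fa Fa' Fa'' hr hs ht e -> ->.
have [t1|t1] := eqVneq t 1.
  have [r0 s0] : r = 0 /\ s = 0 by split; lra.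
  by rewrite t1 r0 s0 !mul0r !mul1r !add0r.
have ht1 : 0 < 1 - t by rewrite lt_neqAle eq_sym subr_eq0 eq_sym t1 /=; lra.
have s01 : 0 <= s / (1 - t) <= 1.
  by rewrite divr_ge0 ?(ltW ht1) //= ler_pdivrMr //; lra.
have Fc := cF _ _ _ _ _ Fa Fa' s01.
apply: (convex2_eq _ _ t _ _ _ _ _ _ cF Fc Fa''); first by lra.
  have -> : r = 1 - t - s by lra.
  by field; rewrite gt_eqF.
have -> : r = 1 - t - s by lra.
by field; rewrite gt_eqF.
Qed.

Lemma convex2_diff2 (R : realType) (F : R -> R -> Prop) :
  convex2 F -> convex2 (diff2 F).
Proof.
move=> cF x y x' y' t [a [b [a' [b' [h1 h2 -> ->]]]]].
move=> [c [d [c' [d' [h3 h4 -> ->]]]]] ht.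
exists ((1 - t) * a + t * c), ((1 - t) * b + t * d).
exists ((1 - t) * a' + t * c'), ((1 - t) * b' + t * d').
by split; [exact: cF | exact: cF | ring | ring].
Qed.

Lemma diff2N (R : realType) (F : R -> R -> Prop) (x y : R) :
  diff2 F x y -> diff2 F (- x) (- y).
Proof.
by move=> [a [b [a' [b' [h1 h2 -> ->]]]]]; exists a', b', a, b; rewrite !opprB.
Qed.

(** * Confinement to the hexagram and to the triangle *)

(** The segment from the third point x z + y w to z - w, if y >= 0, or to w, if y < 0, crosses the
    ray of z beyond z. *)
Lemma convex2_stretch (R : realType) (D : R -> R -> Prop)
    (z1 z2 w1 w2 x y : R) :
  convex2 D -> D w1 w2 -> D (z1 - w1) (z2 - w2) ->
  D (x * z1 + y * w1) (x * z2 + y * w2) -> 1 < x -> 1 < x + y ->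
  exists2 t, 1 < t & D (t * z1) (t * z2).
Proof.
move=> cD Dw Dzw Dy hx hxy.
case: (leP 0 y) => hy.
  exists ((x + y) / (1 + y)); first by rewrite ltr_pdivlMr; lra.
  apply: (convex2_eq _ _ (y / (1 + y)) _ _ _ _ _ _ cD Dy Dzw).
  - by rewrite divr_ge0 /=; [rewrite ler_pdivrMr; lra | lra | lra].
  - by field; lra.
  - by field; lra.
exists (x / (1 - y)); first by rewrite ltr_pdivlMr; lra.
apply: (convex2_eq _ _ ((- y) / (1 - y)) _ _ _ _ _ _ cD Dy Dw).
- by rewrite divr_ge0 /=; [rewrite ler_pdivrMr; lra | lra | lra].
- by field; lra.
- by field; lra.
Qed.

Ltac unit_lra :=
  rewrite ?(mulrN1z, mulr1z, mulr0z, subrr, subr0, sub0r, opprK, addNr, add0r) //; lra.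

(* Outside the hexagram spanned by the hexagon with vertices ±e1, ±e2, ±(e1-e2),
   a point of D pushes one of these six vertices into the interior of D. *)
Lemma hexagram_bound (R : realType) (F : R -> R -> Prop) (x y : R) :
  convex2 F -> no_stretched_lattice F ->
  diff2 F 1 0 -> diff2 F 0 1 -> diff2 F 1 (-1) -> diff2 F x y ->
  [/\ x <= 1, y <= 1 & -1 <= x + y] \/ [/\ -1 <= x, -1 <= y & x + y <= 1].
Proof.
move=> cF nF D10 D01 D11 Dxy.
have cD := convex2_diff2 _ _ cF.
have Dm10 : diff2 F (-1) 0 by rewrite -[0]oppr0; exact: diff2N.
have D0m1 : diff2 F 0 (-1) by rewrite -[0]oppr0; exact: diff2N.
have Dm11 : diff2 F (-1) 1 by rewrite -[X in _ _ X]opprK; exact: diff2N.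
(* For consecutive vertices w, z, z - w of the hexagon, this forbids the region a > 1, a + b > 1 in
   the coordinates of z and w; six such regions are used below. *)
have key (z1 z2 w1 w2 : int) (a b : R) : (z1, z2) != (0, 0) ->
    diff2 F w1%:~R w2%:~R -> diff2 F (z1%:~R - w1%:~R) (z2%:~R - w2%:~R) ->
    x = a * z1%:~R + b * w1%:~R -> y = a * z2%:~R + b * w2%:~R ->
    1 < a -> 1 < a + b -> False.
  move=> z0 Dw Dzw ex ey ha hab.
  have [|t ht Dt] := convex2_stretch _ _ _ _ _ _ a b cD Dw Dzw _ ha hab.
    by rewrite -ex -ey.
  by have [e1 e2] := nF _ _ _ ht Dt; rewrite e1 e2 eqxx in z0.
case: (leP x 1) => hx1; last first.
  right; split; first lra.
    rewrite leNgt; apply/negP => hy.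
    by apply: (key 1 (-1) 1 0 (- y) (x + y)) => //; unit_lra.
  rewrite leNgt; apply/negP => hy.
  by apply: (key 1 0 0 1 x y) => //; unit_lra.
case: (leP y 1) => hy1; last first.
  right; split; [|lra|].
    rewrite leNgt; apply/negP => hy.
    apply: (key (-1) 1 (-1) 0 y (- x - y)) => //; unit_lra.
  rewrite leNgt; apply/negP => hy.
  by apply: (key 0 1 (-1) 1 (x + y) (- x)) => //; unit_lra.
case: (leP (-1) (x + y)) => hs; first by left.
right; split; last lra.
  rewrite leNgt; apply/negP => hx.
  by apply: (key (-1) 0 0 (-1) (- x) (- y)) => //; unit_lra.
rewrite leNgt; apply/negP => hy.
by apply: (key 0 (-1) 1 (-1) (- x - y) x) => //; unit_lra.
Qed.

(** Subtracting each of the three given points of F from (x, y) gives a point of the hexagram, and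
    the three correspondingly shifted hexagrams meet only inside the triangle. *)
Lemma triangle_bound (R : realType) (F : R -> R -> Prop) (x y : R) :
  convex2 F -> no_stretched_lattice F -> F 0 0 -> F (-1) 0 -> F 0 (-1) ->
  F x y -> [/\ -1 <= x, -1 <= y & x + y <= 0].
Proof.
move=> cF nF F00 F10 F01 Fxy.
have D10 : diff2 F 1 0 by exists 0, 0, (-1), 0; split=> //; ring.
have D01 : diff2 F 0 1 by exists 0, 0, 0, (-1); split=> //; ring.
have D11 : diff2 F 1 (-1) by exists 0, (-1), (-1), 0; split=> //; ring.
have hb := hexagram_bound _ _ _ _ cF nF D10 D01 D11.
have h0 : diff2 F x y by exists x, y, 0, 0; split=> //; ring.
have h1 : diff2 F (x + 1) y by exists x, y, (-1), 0; split=> //; ring.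
have h2 : diff2 F x (y + 1) by exists x, y, 0, (-1); split=> //; ring.
by case: (hb _ _ h0) => -[? ? ?]; case: (hb _ _ h1) => -[? ? ?];
  case: (hb _ _ h2) => -[? ? ?]; split; lra.
Qed.

(** * Lattice bases from triple points *)

Lemma int_le_of_ltD1 (R : realType) (m k : int) :
  (m%:~R : R) < k%:~R + 1 -> m <= k.
Proof. by rewrite -[1]/(1%:~R) -intrD ltr_int => h; lia. Qed.

(** The vectors u, v and u - v lie in F - F, so the triangle 0, u, v contains no lattice point that
    could be stretched; hence u and v generate the lattice. Squaring the determinant absorbs its
    sign. *)
Lemma lattice_basis (R : realType) (F : R -> R -> Prop) (p1 p2 : R)
    (u1 u2 v1 v2 : int) :
  convex2 F -> no_stretched_lattice F ->
  F p1 p2 -> F (p1 - u1%:~R) (p2 - u2%:~R) -> F (p1 - v1%:~R) (p2 - v2%:~R) ->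
  (u1, u2) != (0, 0) -> (v1, v2) != (0, 0) -> (u1, u2) != (v1, v2) ->
  (u1 * v2 - u2 * v1) * (u1 * v2 - u2 * v1) = 1.
Proof.
move=> cF nF Fp Fu Fv u0 v0 uv.
have cD := convex2_diff2 _ _ cF.
have Du : diff2 F u1%:~R u2%:~R.
  by exists p1, p2, (p1 - u1%:~R), (p2 - u2%:~R); split=> //; ring.
have Dv : diff2 F v1%:~R v2%:~R.
  by exists p1, p2, (p1 - v1%:~R), (p2 - v2%:~R); split=> //; ring.
have Duv : diff2 F (u1%:~R - v1%:~R) (u2%:~R - v2%:~R).
  exists (p1 - v1%:~R), (p2 - v2%:~R), (p1 - u1%:~R), (p2 - u2%:~R).
  by split=> //; ring.
have stretch (m n : int) (t x y : R) : (m, n) != (0, 0) -> diff2 F x y -> 1 < t ->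
    x = t * m%:~R -> y = t * n%:~R -> False.
  move=> mn Dxy ht ex ey; rewrite ex ey in Dxy.
  by have [e1 e2] := nF _ _ _ ht Dxy; rewrite e1 e2 eqxx in mn.
(* If v = t u, then one of u, v is a stretch of the other (t > 0), or u - v is a stretch of u (t <
   0), unless v = 0 or u = v. *)
have dN0 : u1 * v2 - u2 * v1 != 0.
  apply/eqP => d0.
  have d0R : (u1%:~R * v2%:~R - u2%:~R * v1%:~R : R) = 0.
    by rewrite -!intrM -intrB d0.
  have [t e1 e2] : exists2 t : R, v1%:~R = t * u1%:~R & v2%:~R = t * u2%:~R.
    have [u10|u10] := eqVneq u1 0.
      have u20 : u2 != 0 by apply: contra u0 => /eqP ->; rewrite u10.
      have u20R : (u2%:~R : R) != 0 by rewrite intr_eq0.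
      exists (v2%:~R / u2%:~R); last by field.
      apply: (mulfI u20R); rewrite u10 mulr0z mulr0 mulr0.
      by move: d0R; rewrite u10 mulr0z; lra.
    have u10R : (u1%:~R : R) != 0 by rewrite intr_eq0.
    exists (v1%:~R / u1%:~R); first by field.
    apply: (mulfI u10R); rewrite mulrA mulrCA divff // mulr1.
    by move: d0R; lra.
  have [t1|t1|t1] := ltgtP 1 t.
  - exact: (stretch u1 u2 t _ _ u0 Dv t1 e1 e2).
  - have [t0|t0|t0] := ltgtP 0 t.
    + apply: (stretch v1 v2 t^-1 _ _ v0 Du _ _ _).
      * by rewrite invf_gt1.
      * by rewrite e1 mulKf // gt_eqF.
      * by rewrite e2 mulKf // gt_eqF.
    + apply: (stretch u1 u2 (1 - t) _ _ u0 Duv _ _ _); first lra.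
      * by rewrite e1; ring.
      * by rewrite e2; ring.
    + move: e1 e2; rewrite -t0 !mul0r => /eqP + /eqP.
      by rewrite !intr_eq0 => /eqP e1 /eqP e2; rewrite e1 e2 eqxx in v0.
  - move: e1 e2; rewrite -t1 !mul1r => /eqP + /eqP.
    by rewrite !eqr_int => /eqP e1 /eqP e2; rewrite e1 e2 eqxx in uv.
have dR : (u1%:~R * v2%:~R - u2%:~R * v1%:~R : R) != 0.
  by rewrite -!intrM -intrB intr_eq0.
(* Subtracting floors leaves a lattice point w = a u + b v of the half-open parallelogram. Below the
   diagonal w is 0; above it u + v - w is 0; on it u - w = b (u - v) would be stretched to u - v. *)
have gen (z1 z2 : int) : exists m n : int,
    z1 = m * u1 + n * v1 /\ z2 = m * u2 + n * v2.
  have [A [B [ez1 ez2]]] : exists A B : R,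
      z1%:~R = A * u1%:~R + B * v1%:~R /\ z2%:~R = A * u2%:~R + B * v2%:~R.
    pose d : R := u1%:~R * v2%:~R - u2%:~R * v1%:~R.
    exists ((z1%:~R * v2%:~R - z2%:~R * v1%:~R) / d).
    exists ((u1%:~R * z2%:~R - u2%:~R * z1%:~R) / d).
    by rewrite /d; split; field.
  pose m := Num.floor A; pose n := Num.floor B.
  have /andP[a0 +] := floor_itv A; rewrite rmorphD /= -/m => a1.
  have /andP[b0 +] := floor_itv B; rewrite rmorphD /= -/n => b1.
  (* A nonzero lattice point r u + s v of the half-open triangle would be stretched
     to the side [u, v] of D. *)
  have tri (w1 w2 : int) (r s : R) : 0 <= r -> 0 <= s -> r + s < 1 ->
      w1%:~R = r * u1%:~R + s * v1%:~R -> w2%:~R = r * u2%:~R + s * v2%:~R ->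
      w1 = 0 /\ w2 = 0.
    move=> hr hs hrs ew1 ew2.
    have [rs0|rs0] := eqVneq (r + s) 0.
      have [r0 s0] : r = 0 /\ s = 0 by split; lra.
      move: ew1 ew2; rewrite r0 s0 !mul0r !addr0 => /eqP + /eqP.
      by rewrite !intr_eq0 => /eqP -> /eqP ->.
    have rs : 0 < r + s by lra.
    apply: (nF _ _ (r + s)^-1); first by rewrite invf_gt1.
    apply: (convex2_eq _ _ (s / (r + s)) _ _ _ _ _ _ cD Du Dv).
    - by rewrite divr_ge0 /=; [rewrite ler_pdivrMr; lra | lra | lra].
    - by rewrite ew1; field.
    - by rewrite ew2; field.
  pose w1 := z1 - m * u1 - n * v1; pose w2 := z2 - m * u2 - n * v2.
  pose a : R := A - m%:~R; pose b : R := B - n%:~R.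
  have ew1 : w1%:~R = a * u1%:~R + b * v1%:~R.
    by rewrite !rmorphB !rmorphM /= ez1 /a /b; ring.
  have ew2 : w2%:~R = a * u2%:~R + b * v2%:~R.
    by rewrite !rmorphB !rmorphM /= ez2 /a /b; ring.
  have ha : 0 <= a < 1 by rewrite /a; lra.
  have hb : 0 <= b < 1 by rewrite /b; lra.
  clear ez1 ez2 a0 a1 b0 b1; clearbody a b.
  have [h|h|h] := ltgtP (a + b) 1.
  - exists m, n.
    have [|||h1 h2] := tri _ _ _ _ _ _ _ ew1 ew2; try lra.
    by split; [move: h1; rewrite /w1 | move: h2; rewrite /w2]; lra.
  - exists (m + 1), (n + 1).
    have e1 : (u1 + v1 - w1)%:~R = (1 - a) * u1%:~R + (1 - b) * v1%:~R.
      by rewrite rmorphB rmorphD /= ew1; ring.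
    have e2 : (u2 + v2 - w2)%:~R = (1 - a) * u2%:~R + (1 - b) * v2%:~R.
      by rewrite rmorphB rmorphD /= ew2; ring.
    have [|||h1 h2] := tri _ _ _ _ _ _ _ e1 e2; try lra.
    by split; [move: h1; rewrite /w1 | move: h2; rewrite /w2]; lra.
  - exfalso; have b0' : b != 0 by lra.
    have e1 : (u1 - w1)%:~R = b * (u1%:~R - v1%:~R).
      by rewrite rmorphB /= ew1 (_ : a = 1 - b); [ring | lra].
    have e2 : (u2 - w2)%:~R = b * (u2%:~R - v2%:~R).
      by rewrite rmorphB /= ew2 (_ : a = 1 - b); [ring | lra].
    apply: (stretch (u1 - w1) (u2 - w2) b^-1 _ _ _ Duv).
    + apply: contra uv => /eqP [h1 h2]; rewrite h1 h2 !mulr0z in e1 e2.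
      move/esym/eqP: e1; rewrite mulf_eq0 (negPf b0') subr_eq0 eqr_int => /eqP ->.
      by move/esym/eqP: e2; rewrite mulf_eq0 (negPf b0') subr_eq0 eqr_int => /eqP ->.
    + by rewrite invf_gt1; lra.
    + by rewrite e1 mulKf.
    + by rewrite e2 mulKf.
have [m [n [e1 e2]]] := gen 1 0.
have [m' [n' [e3 e4]]] := gen 0 1.
(* Both e1 and e2 are integer combinations of u and v, so the determinant of u, v is a unit of Z. *)
have e : (m * n' - n * m') * (u1 * v2 - u2 * v1) = 1.
  have -> : (m * n' - n * m') * (u1 * v2 - u2 * v1) =
     (m * u1 + n * v1) * (m' * u2 + n' * v2) - (m * u2 + n * v2) * (m' * u1 + n' * v1) by ring.
  by rewrite -e1 -e2 -e3 -e4.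
have /intUnitRing.unitzPl : (m * n' - n * m') * (u1 * v2 - u2 * v1) = 1 by [].
by rewrite qualifE /= => /orP[] /eqP ->.
Qed.

(** * The covering hexagon and the lattice-free triangle *)

(** In the unit square, K + e1 + e2 contains the half conv(e1, e2, e1 + e2). In the other half
    conv(0, e1, e2), the sets K + e1, K + e2 and K + e1 + e2 all contain d and each contains one
    side. *)
Lemma hexagon_covers (R : realType) (K : R -> R -> Prop) (d1 d2 x y : R) :
  convex2 K -> K 0 0 -> K (-1) 0 -> K 0 (-1) ->
  0 <= d1 -> 0 <= d2 -> d1 + d2 <= 1 ->
  K (d1 - 1) d2 -> K d1 (d2 - 1) -> K (d1 - 1) (d2 - 1) ->
  exists m n : int, K (x - m%:~R) (y - n%:~R).
Proof.
move=> cK K00 K10 K01 h1 h2 h12 Kd1 Kd2 Kd12.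
suff unit_square (a b : R) : 0 <= a < 1 -> 0 <= b < 1 ->
    exists m n : int, K (a - m%:~R) (b - n%:~R).
  have [||m [n h]] := unit_square (x - (Num.floor x)%:~R) (y - (Num.floor y)%:~R).
  - by have := floor_itv x; rewrite rmorphD /=; lra.
  - by have := floor_itv y; rewrite rmorphD /=; lra.
  by exists (Num.floor x + m), (Num.floor y + n); rewrite !rmorphD /= !opprD !addrA.
move=> ha hb; case: (leP 1 (a + b)) => hab.
  exists 1, 1.
  apply: (convex2_three _ _ (a + b - 1) (1 - b) (1 - a) _ _ _ _ _ _ _ _
    cK K00 K01 K10);
    rewrite ?mulr1z; lra.
(* Cut the triangle (0, e1, e2) into three from d: the point (a, b) is in the part
   opposite to a vertex whose barycentric weight, relative to that of d, is least. *)
have pick3 (x0 x1 x2 d0 : R) : 0 < x0 -> 0 <= x1 -> 0 <= x2 -> 0 <= d0 ->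
    d0 + d1 + d2 = 1 ->
    [\/ [/\ 0 < d0, x0 * d1 <= x1 * d0 & x0 * d2 <= x2 * d0],
        [/\ 0 < d1, x1 * d0 <= x0 * d1 & x1 * d2 <= x2 * d1] |
        [/\ 0 < d2, x2 * d0 <= x0 * d2 & x2 * d1 <= x1 * d2]].
  move=> x0p x1p x2p d0p dsum.
  have [l01|/[dup] l01 /ltW l01'] := leP (x0 * d1) (x1 * d0).
    have [d00|d00] := ltP 0 d0; last first.
      have d0z : d0 = 0 by lra.
      have d1z : d1 = 0.
        by move: l01; rewrite d0z mulr0 pmulr_rle0 //; lra.
      by constructor 3; rewrite d0z d1z !mulr0; split; [lra | apply: mulr_ge0; lra..].
    have [l02|/[dup] l02 /ltW l02'] := leP (x0 * d2) (x2 * d0); first by constructor 1.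
    constructor 3; split=> //; first by nra.
    by rewrite -(ler_pM2l d00); nra.
  have d1p : 0 < d1 by nra.
  have [l12|/[dup] l12 /ltW l12'] := leP (x1 * d2) (x2 * d1); first by constructor 2.
  constructor 3; split=> //; first by nra.
  by rewrite -(ler_pM2l d1p); nra.
have [||||| [h0 ha0 hb0] | [h0 ha0 hb0] | [h0 ha0 hb0]] :=
    pick3 (1 - a - b) a b (1 - d1 - d2); try lra.
(* Here t is the weight of d: the vertex opposite to the part gets weight 0, and the choice made by
   [pick3] keeps the other two weights nonnegative. *)
- pose t := (1 - a - b) / (1 - d1 - d2).
  have e : t * (1 - d1 - d2) = 1 - a - b by rewrite divfK //; lra.
  have t0 : 0 <= t by rewrite divr_ge0; lra.
  have ht1 : t * d1 <= a by rewrite /t mulrAC ler_pdivrMr //; lra.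
  have ht2 : t * d2 <= b by rewrite /t mulrAC ler_pdivrMr //; lra.
  exists 1, 1.
  apply: (convex2_three _ _ t (a - t * d1) (b - t * d2) _ _ _ _ _ _ _ _ cK Kd12 K01 K10);
    rewrite ?mulr1z; lra.
- pose t := a / d1.
  have e : t * d1 = a by rewrite divfK //; lra.
  have t0 : 0 <= t by rewrite divr_ge0; lra.
  have ht1 : t * (1 - d1 - d2) <= 1 - a - b by rewrite /t mulrAC ler_pdivrMr //; lra.
  have ht2 : t * d2 <= b by rewrite /t mulrAC ler_pdivrMr //; lra.
  exists 0, 1.
  apply: (convex2_three _ _ t (1 - a - b - t * (1 - d1 - d2)) (b - t * d2) _ _ _ _ _ _ _ _
    cK Kd2 K01 K00);
    rewrite ?mulr1z ?mulr0z; lra.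
- pose t := b / d2.
  have e : t * d2 = b by rewrite divfK //; lra.
  have t0 : 0 <= t by rewrite divr_ge0; lra.
  have ht1 : t * (1 - d1 - d2) <= 1 - a - b by rewrite /t mulrAC ler_pdivrMr //; lra.
  have ht2 : t * d1 <= a by rewrite /t mulrAC ler_pdivrMr //; lra.
  exists 1, 0.
  apply: (convex2_three _ _ t (1 - a - b - t * (1 - d1 - d2)) (a - t * d1) _ _ _ _ _ _ _ _
    cK Kd1 K10 K00);
    rewrite ?mulr1z ?mulr0z; lra.
Qed.

(** With c = (1 - mu) / 2, the inequality c + mu < 1 forces m and n to be at most 0, while 2 c > 0
    forces m + n > 0. *)
Lemma shrunk_triangle_misses (R : realType) (mu s1 s2 : R) (m n : int) :
  0 <= mu < 1 -> -1 <= s1 -> -1 <= s2 -> s1 + s2 <= 0 ->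
  (1 - mu) / 2 - m%:~R = mu * s1 -> (1 - mu) / 2 - n%:~R = mu * s2 -> False.
Proof.
move=> hmu h1 h2 h12 e1 e2.
have m0 : m <= 0 by apply: (@int_le_of_ltD1 R); rewrite mulr0z; nra.
have n0 : n <= 0 by apply: (@int_le_of_ltD1 R); rewrite mulr0z; nra.
have : (m%:~R : R) <= 0%:~R by rewrite ler_int.
have : (n%:~R : R) <= 0%:~R by rewrite ler_int.
rewrite mulr0z; nra.
Qed.

(** * Closed planar sets, connectedness and compactness *)

Definition closed2 {R : realType} (F : R -> R -> Prop) : Prop :=
  closed [set s : R * R | F s.1 s.2].

Lemma closed2_far (R : realType) (F : R -> R -> Prop) (x y : R) :
  closed2 F -> ~ F x y ->
  exists2 e : R, 0 < e &
    forall x' y', `|x' - x| < e -> `|y' - y| < e -> ~ F x' y'.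
Proof.
move=> /closed_openC oF nF.
have /nbhs_ballP[e /= e0 he] := open_nbhs_nbhs (conj oF nF : open_nbhs (x, y) _).
by exists e => // x' y' hx hy; apply: (he (x', y')); split; rewrite /ball /= distrC.
Qed.

Lemma continuous_pair (R : realType) (T : topologicalType) (f g : T -> R) :
  continuous f -> continuous g -> continuous (fun t => (f t, g t)).
Proof. by move=> cf cg t; exact: (cvg_pair (cf t) (cg t)). Qed.

Lemma closed2_shift (R : realType) (F : R -> R -> Prop) (a b : R) :
  closed2 F -> closed2 (fun x y => F (x - a) (y - b)).
Proof.
move=> cF; apply: (@preimage_closed _ _ (fun s : R * R => (s.1 - a, s.2 - b)) _ _ cF).
move=> s _; apply: continuous_pair => {}s; (apply: cvgB; last exact: cvg_cst).
  exact: cvg_fst.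
exact: cvg_snd.
Qed.

(** Connectedness of the unit interval. The common point is the supremum of A in [0, 1]: points just
    beyond it are in B, and B is closed. *)
Lemma segment_meet (R : realType) (A B : set R) :
  closed A -> closed B -> A 0 -> B 1 ->
  (forall t, 0 <= t <= 1 -> A t \/ B t) ->
  exists2 t, 0 <= t <= 1 & A t /\ B t.
Proof.
move=> cA cB A0 B1 AB.
pose E := A `&` [set t : R | 0 <= t <= 1].
have E0 : E 0 by split => //=; rewrite lexx ler01.
have supE : has_sup E by split; [exists 0 | exists 1 => t [_ /andP[]]].
have s01 : 0 <= sup E <= 1.
  rewrite ub_le_sup //=; last exact: supE.2.
  by apply: ge_sup; [exists 0 | move=> t [_ /andP[]]].
exists (sup E) => //.
have As : A (sup E).
  apply: contrapT => nA.
  have /nbhs_ballP[e /= e0 he] := open_nbhs_nbhs (conj (closed_openC cA) nA : open_nbhs _ _).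
  have [t [At ht] hlt] := sup_adherent e0 supE.
  have hle : t <= sup E by apply: ub_le_sup; [exact: supE.2 | split].
  by apply: (he t) => //; rewrite /ball /= ger0_norm; lra.
split=> //; apply: contrapT => nB.
have /nbhs_ballP[e /= e0 he] := open_nbhs_nbhs (conj (closed_openC cB) nB : open_nbhs _ _).
have [s1|s1] := eqVneq (sup E) 1; first by apply: nB; rewrite s1.
have {}s1 : sup E < 1 by rewrite lt_neqAle s1; case/andP: s01.
pose t := Num.min 1 (sup E + e / 2).
have tle1 : t <= 1 by rewrite ge_min lexx.
have tles : t <= sup E + e / 2 by rewrite ge_min lexx orbT.
have tgt : sup E < t by rewrite lt_min s1 /=; lra.
have h01t : 0 <= t <= 1 by lra.
have [At|Bt] := AB t h01t.
  have : t <= sup E by apply: ub_le_sup; [exact: supE.2 | split=> //=; lra].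
  by lra.
by apply: (he t) => //; rewrite /ball /= ltr0_norm; lra.
Qed.

Lemma closed2_segment (R : realType) (F : R -> R -> Prop) (a b a' b' : R) :
  closed2 F ->
  closed [set t : R | F ((1 - t) * a + t * a') ((1 - t) * b + t * b')].
Proof.
move=> cF.
apply: (@preimage_closed _ _
  (fun t : R => ((1 - t) * a + t * a', (1 - t) * b + t * b') : R * R) _ _ cF).
move=> t _; apply: continuous_pair => {}t; apply: cvgD; apply: cvgM;
  try exact: cvg_cst; try exact: cvg_id;
  by apply: cvgB; [exact: cvg_cst | exact: cvg_id].
Qed.

Lemma closed2_argmax (R : realType) (F : R -> R -> Prop) (f : R * R -> R) (x0 y0 M : R) :
  closed2 F -> (forall x y, F x y -> `|x| <= M /\ `|y| <= M) -> continuous f ->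
  F x0 y0 ->
  exists x1 y1, F x1 y1 /\ forall x y, F x y -> f (x, y) <= f (x1, y1).
Proof.
move=> cF bF cf F0.
have kF : compact [set s : R * R | F s.1 s.2].
  apply: (@subclosed_compact _ _ (`[- M, M]%classic `*` `[- M, M]%classic)) => //.
    by apply: compact_setX; exact: segment_compact.
  by move=> [x y] /= /bF[]; rewrite !in_itv /= !ler_norml.
have F0' : [set s : R * R | F s.1 s.2] !=set0 by exists (x0, y0).
have [[x1 y1] + hmax] := compact_EVT_max F0' kF (continuous_subspaceT cf).
rewrite inE => F1; exists x1, y1; split=> // x y Fxy.
by apply: hmax; rewrite inE.
Qed.

(** * The second triple point of the hexagonal tiling *)

(** The sets A = F + e1, B = F + e2 and C = F + e1 + e2 cover the triangle conv(0, e1, e2), and each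
    contains one side. A point d of A and B in the triangle with largest coordinate sum must lie in
    C. *)
Lemma opposite_triple_point (R : realType) (F : R -> R -> Prop) :
  convex2 F -> closed2 F -> F 0 0 -> F (-1) 0 -> F 0 (-1) ->
  (forall x y, F x y -> [/\ -1 <= x, -1 <= y & x + y <= 0]) ->
  (forall x y, exists m n : int, F (x - m%:~R) (y - n%:~R)) ->
  exists d1 d2, [/\ 0 <= d1, 0 <= d2 & d1 + d2 <= 1] /\
    [/\ F (d1 - 1) d2, F d1 (d2 - 1) & F (d1 - 1) (d2 - 1)].
Proof.
move=> cF kF F00 F10 F01 bF coverF.
pose T x y := [/\ 0 <= x :> R, 0 <= y :> R & x + y <= 1].
pose A x y := F (x - 1) y; pose B x y := F x (y - 1); pose C x y := F (x - 1) (y - 1).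
have shift (a b : R) : convex2 (fun x y => F (x - a) (y - b)).
  move=> x y x' y' t h1 h2 ht.
  by apply: (convex2_eq _ _ t _ _ _ _ _ _ cF h1 h2 ht); ring.
have cA : convex2 A by have := shift 1 0; under eq_fun do under eq_fun do rewrite subr0.
have cB : convex2 B by have := shift 0 1; under eq_fun do under eq_fun do rewrite subr0.
have kA : closed2 A.
  by have := closed2_shift _ _ 1 0 kF; under eq_fun do under eq_fun do rewrite subr0.
have kB : closed2 B.
  by have := closed2_shift _ _ 0 1 kF; under eq_fun do under eq_fun do rewrite subr0.
have cC : convex2 C by exact: shift.
have kC : closed2 C by exact: closed2_shift.
have A00 : A 0 0 by rewrite /A sub0r.
have A10 : A 1 0 by rewrite /A subrr.
have B00 : B 0 0 by rewrite /B sub0r.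
have B01 : B 0 1 by rewrite /B subrr.
have C10 : C 1 0 by rewrite /C subrr sub0r.
have C01 : C 0 1 by rewrite /C subrr sub0r.
have TABC x y : T x y -> [\/ A x y, B x y | C x y].
  case=> hx hy hxy.
  have [x0|x0] := eqVneq x 0.
    by constructor 2; apply: (convex2_eq _ _ y _ _ _ _ _ _ cB B00 B01); lra.
  have [y0|y0] := eqVneq y 0.
    by constructor 1; apply: (convex2_eq _ _ x _ _ _ _ _ _ cA A00 A10); lra.
  have [s0|s0] := eqVneq (x + y) 1.
    by constructor 3; apply: (convex2_eq _ _ y _ _ _ _ _ _ cC C10 C01); lra.
  (* Off the three sides, the confinement of F leaves only m, n <= 1 and m + n > 0. *)
  have [m [n Fmn]] := coverF x y.
  have [h1 h2 h3] := bF _ _ Fmn.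
  have m1 : m <= 1 by apply: (int_le_of_ltD1 R); rewrite mulr1z; lra.
  have n1 : n <= 1 by apply: (int_le_of_ltD1 R); rewrite mulr1z; lra.
  have mn : 0 < m + n by rewrite -(ltr0z R) rmorphD /=; lra.
  have [[em en]|[[em en]|[em en]]] :
    (m = 1 /\ n = 0) \/ (m = 0 /\ n = 1) \/ (m = 1 /\ n = 1) by lia.
  - by constructor 1; move: Fmn; rewrite em en mulr1z mulr0z subr0.
  - by constructor 2; move: Fmn; rewrite em en mulr1z mulr0z subr0.
  - by constructor 3; move: Fmn; rewrite em en mulr1z.
pose E x y := [/\ T x y, A x y & B x y].
have kT : closed2 T.
  have -> : T = fun x y => ([set s : R * R | 0 <= s.1] `&` [set s : R * R | 0 <= s.2]
       `&` [set s : R * R | s.1 + s.2 <= 1]) (x, y).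
    by apply/funext => x; apply/funext => y; apply/propext; split=> [[]|[[]]].
  apply: closedI; first apply: closedI.
  - apply: (@preimage_closed _ _ fst [set x : R | 0 <= x]); last exact: closed_ge.
    by move=> s _; exact: cvg_fst.
  - apply: (@preimage_closed _ _ snd [set x : R | 0 <= x]); last exact: closed_ge.
    by move=> s _; exact: cvg_snd.
  - apply: (@preimage_closed _ _ (fun s : R * R => s.1 + s.2) [set x : R | x <= 1]);
      last exact: closed_le.
    by move=> s _; apply: cvgD; [exact: cvg_fst | exact: cvg_snd].
have kE : closed2 E.
  rewrite /closed2 (_ : [set _ | _] = [set s : R * R | T s.1 s.2]
     `&` [set s : R * R | A s.1 s.2] `&` [set s : R * R | B s.1 s.2]).
    by apply: closedI => //; apply: closedI.
  by apply/seteqP; split=> s /= [[]].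
have bE x y : E x y -> `|x| <= 1 /\ `|y| <= 1.
  by case=> -[? ? ?] _ _; split; rewrite ger0_norm //; lra.
have csum : continuous (fun s : R * R => s.1 + s.2).
  by move=> s; apply: cvgD; [exact: cvg_fst | exact: cvg_snd].
have E00 : E 0 0 by split=> //; split; lra.
have [d1 [d2 [[[h1 h2 h12] Ad Bd] dmax]]] := closed2_argmax _ _ _ _ _ _ kE bE csum E00.
exists d1, d2; split=> //; split=> //; change (C d1 d2).
have [s1|s1] := eqVneq (d1 + d2) 1.
  by apply: (convex2_eq _ _ d2 _ _ _ _ _ _ cC C10 C01); lra.
have {}s1 : d1 + d2 < 1 by rewrite lt_neqAle s1.
(* If C misses d, a short segment parallel to [e1, e2] just above d is covered by A and B,
   hence meets A and B in a common point, contradicting the choice of d. *)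
apply: contrapT => nC.
have [e e0 farC] := closed2_far _ _ _ _ kC nC.
pose t := Num.min 1 (e / 4).
have t1 : t <= 1 by rewrite ge_min lexx.
have te : t <= e / 4 by rewrite ge_min lexx orbT.
have t0 : 0 < t by rewrite lt_min ltr01 /=; lra.
clearbody t.
(* Moving d towards e1 stays in A and towards e2 stays in B; either way the coordinate sum grows by
   t (1 - d1 - d2) > 0. *)
pose a1 := (1 - t) * d1 + t; pose a2 := (1 - t) * d2.
pose b1 := (1 - t) * d1; pose b2 := (1 - t) * d2 + t.
have Aa : A a1 a2 by apply: (convex2_eq _ _ t _ _ _ _ _ _ cA Ad A10); rewrite /a1 /a2; lra.
have Bb : B b1 b2 by apply: (convex2_eq _ _ t _ _ _ _ _ _ cB Bd B01); rewrite /b1 /b2; lra.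
have Tab r : 0 <= r <= 1 -> T ((1 - r) * a1 + r * b1) ((1 - r) * a2 + r * b2).
  by move=> hr; split; rewrite /a1 /a2 /b1 /b2; nra.
have [|||r hr [Ar Br]] := segment_meet _ _ _ (closed2_segment _ _ a1 a2 b1 b2 kA)
    (closed2_segment _ _ a1 a2 b1 b2 kB).
- by rewrite /= subr0 !mul1r !mul0r !addr0.
- by rewrite /= subrr !mul1r !mul0r !add0r.
- move=> r hr; have [h|h|h] := TABC _ _ (Tab r hr); [by left | by right |].
  exfalso; apply: farC h; rewrite /a1 /a2 /b1 /b2 ltr_norml; nra.
- have := dmax _ _ (And3 (Tab r hr) Ar Br); rewrite /= /a1 /a2 /b1 /b2; nra.
Qed.

(** * Interior points and packing *)

Definition box_in {R : realType} (F : R -> R -> Prop) (c1 c2 e : R) : Prop :=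
  forall x y, `|x - c1| < e -> `|y - c2| < e -> F x y.

Definition packing2 {R : realType} (F : R -> R -> Prop) : Prop :=
  forall (m n : int) (c1 c2 e : R), 0 < e -> box_in F c1 c2 e ->
    box_in (fun x y => F (x - m%:~R) (y - n%:~R)) c1 c2 e -> m = 0 /\ n = 0.

Definition covering2 {R : realType} (F : R -> R -> Prop) : Prop :=
  forall x y, exists m n : int, F (x - m%:~R) (y - n%:~R).

(** The barycentric coordinates of the centroid are 1/3. By Cramer's rule r and s stay within 1/6 on
    a box of radius |d| / (6 M), so all three weights remain nonnegative. *)
Lemma box_in_triangle (R : realType) (F : R -> R -> Prop)
    (a1 a2 b1 b2 c1 c2 : R) :
  convex2 F -> F a1 a2 -> F b1 b2 -> F c1 c2 ->
  (b1 - a1) * (c2 - a2) - (b2 - a2) * (c1 - a1) != 0 ->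
  exists g1 g2, exists2 e : R, 0 < e & box_in F g1 g2 e.
Proof.
move=> cF Fa Fb Fc; set d := (X in X != 0) => d0.
pose M := 1 + `|b1 - a1| + `|b2 - a2| + `|c1 - a1| + `|c2 - a2|.
have nb1 := normr_ge0 (b1 - a1); have nb2 := normr_ge0 (b2 - a2).
have nc1 := normr_ge0 (c1 - a1); have nc2 := normr_ge0 (c2 - a2).
have M0 : 0 < M by rewrite /M; lra.
exists ((a1 + b1 + c1) / 3), ((a2 + b2 + c2) / 3), (`|d| / (6 * M)).
  by rewrite divr_gt0 ?normr_gt0 // mulr_gt0.
move=> x y; set h := x - _; set k := y - _ => hx hy.
have small (p q : R) : `|p| + `|q| <= M -> `|(h * p - k * q) / d| <= 1 / 6.
  move=> pq; rewrite normrM normfV ler_pdivrMr ?normr_gt0 //.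
  apply: (le_trans (ler_normB _ _)); rewrite !normrM.
  have eM : `|d| / (6 * M) * M = 1 / 6 * `|d| by field; lra.
  have e0 : 0 < `|d| / (6 * M) by rewrite divr_gt0 ?normr_gt0 // mulr_gt0.
  rewrite -eM; apply: (@le_trans _ _ (`|d| / (6 * M) * (`|p| + `|q|))).
    by rewrite mulrDr lerD // ler_wpM2r // ltW.
  by rewrite ler_pM2l.
have /small : `|c2 - a2| + `|c1 - a1| <= M by rewrite /M; lra.
have /small : `|b2 - a2| + `|b1 - a1| <= M by rewrite /M; lra.
set s := (X in `|X| <= _) => hs; set r := (X in `|X| <= _) => hr.
move: hr hs; rewrite !ler_norml => hr hs.
apply: (convex2_three _ _ (1 / 3 - r + s) (1 / 3 + r) (1 / 3 - s)
  _ _ _ _ _ _ _ _ cF Fa Fb Fc); try lra.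
- have -> : x = h + (a1 + b1 + c1) / 3 by rewrite /h; ring.
  by rewrite /r /s /d; field.
- have -> : y = k + (a2 + b2 + c2) / 3 by rewrite /k; ring.
  by rewrite /r /s /d; field.
Qed.

Lemma box_in_shrink (R : realType) (F : R -> R -> Prop) (a1 a2 c1 c2 e t : R) :
  convex2 F -> F a1 a2 -> box_in F c1 c2 e -> 0 < t <= 1 ->
  box_in F ((1 - t) * a1 + t * c1) ((1 - t) * a2 + t * c2) (t * e).
Proof.
move=> cF Fa bF /andP[t0 t1] x y hx hy.
have scale (p a c : R) : `|p - ((1 - t) * a + t * c)| < t * e ->
    `|(p - (1 - t) * a) / t - c| < e.
  have -> : p - ((1 - t) * a + t * c) = t * ((p - (1 - t) * a) / t - c).
    by field; rewrite gt_eqF.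
  by rewrite normrM gtr0_norm // ltr_pM2l.
apply: (convex2_eq _ _ t _ _ _ _ _ _ cF Fa (bF _ _ (scale _ _ _ hx) (scale _ _ _ hy))).
- by rewrite ltW.
- by field; rewrite gt_eqF.
- by field; rewrite gt_eqF.
Qed.

(** Otherwise [0, 1] would be countable, hence of Lebesgue measure 0. *)
Lemma uncountable_line (R : realType) (g : int * int -> R) :
  exists x, forall z, g z != x.
Proof.
apply: contrapT => /forallNP h.
have rg : range g = [set: R].
  apply/seteqP; split=> // x _; have := h x.
  by move=> /existsNP[z /negP]; rewrite negbK => /eqP <-; exists z.
have cI : countable (`[0, 1]%classic : set R).
  apply: (@sub_countable _ _ _ (range g)); first by rewrite rg; exact: subset_card_le.
  exact: (card_le_trans (card_image_le _ _) (countableP _)).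
have := countable_lebesgue_measure0 cI.
rewrite lebesgue_measure_itv /= lte_fin ltr01 => /eqP.
by rewrite -EFinB eqe subr0 oner_eq0.
Qed.

(** Without interior, F lies on a line, and its lattice translates lie on countably many parallel
    lines, which cannot exhaust a common normal. *)
Lemma interior_nonempty (R : realType) (F : R -> R -> Prop) :
  convex2 F -> covering2 F ->
  exists c1 c2, exists2 e : R, 0 < e & box_in F c1 c2 e.
Proof.
move=> cF vF; apply: contrapT => nbox.
have flat a1 a2 b1 b2 c1 c2 : F a1 a2 -> F b1 b2 -> F c1 c2 ->
    (b1 - a1) * (c2 - a2) - (b2 - a2) * (c1 - a1) = 0.
  move=> Fa Fb Fc; apply/eqP; apply: contrapT => /negP d0; apply: nbox.
  exact: (box_in_triangle _ _ _ _ _ _ _ _ cF Fa Fb Fc d0).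
have [m0 [n0 Fa]] := vF 0 0; set a1 := 0 - _ in Fa; set a2 := 0 - _ in Fa.
have [n1 [n2 [n12 line]]] : exists n1 n2 : R, n1 ^+ 2 + n2 ^+ 2 != 0 /\
    forall x y, F x y -> n1 * (x - a1) + n2 * (y - a2) = 0.
  have [[b1 [b2 [Fb ab]]]|nb] :=
      pselect (exists b1 b2, F b1 b2 /\ (a1, a2) != (b1, b2)).
    exists (a2 - b2), (b1 - a1); split.
      rewrite paddr_eq0 ?sqr_ge0 // !sqrf_eq0 !subr_eq0.
      by apply: contra ab => /andP[/eqP -> /eqP ->].
    by move=> x y Fxy; have := flat _ _ _ _ _ _ Fa Fb Fxy; lra.
  (* F is a single point here, and any line through it will do. *)
  exists 1, 0; split; first by rewrite expr1n expr0n addr0 oner_eq0.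
  move=> x y Fxy; have [/eqP[<- <-]|h] := boolP ((a1, a2) == (x, y)).
    by rewrite !subrr !mulr0 addr0.
  by exfalso; apply: nb; exists x, y.
have [x hx] := uncountable_line _
  (fun z => (n1 * z.1%:~R + n2 * z.2%:~R) / (n1 ^+ 2 + n2 ^+ 2)).
have [m [n Fmn]] := vF (a1 + x * n1) (a2 + x * n2).
have /negP := hx (m, n); apply; apply/eqP => /=.
have := line _ _ Fmn => e.
apply: (mulIf n12); rewrite divfK //; lra.
Qed.

(** If a - b = t z with t > 1, shrinking one box of F towards a and towards b by the ratio 1 - 1/t
    gives two boxes in F that differ by z, so F and F + z overlap. *)
Lemma packing2_no_stretched (R : realType) (F : R -> R -> Prop) :
  convex2 F -> covering2 F -> packing2 F -> no_stretched_lattice F.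
Proof.
move=> cF vF pF m n t t1 [a1 [a2 [b1 [b2 [Fa Fb e1 e2]]]]].
have [c1 [c2 [e e0 bF]]] := interior_nonempty _ _ cF vF.
have t0 : 0 < t by lra.
pose s := 1 - t^-1.
have hs : 0 < s <= 1.
  by rewrite /s subr_gt0 invf_lt1 // t1 /= gerBl invr_ge0 ltW.
have s1 : (1 - s) * t = 1 by rewrite /s subKr mulVf // gt_eqF.
apply: (pF m n ((1 - s) * a1 + s * c1) ((1 - s) * a2 + s * c2) (s * e)).
- by rewrite mulr_gt0 //; case/andP: hs.
- exact: box_in_shrink.
- move=> x y hx hy; apply: (box_in_shrink _ _ _ _ _ _ _ _ cF Fb bF hs).
  + rewrite (_ : _ - _ = x - ((1 - s) * a1 + s * c1)) //.
    have -> : a1 = b1 + t * m%:~R by lra.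
    by rewrite mulrDr mulrA s1; ring.
  + rewrite (_ : _ - _ = y - ((1 - s) * a2 + s * c2)) //.
    have -> : a2 = b2 + t * n%:~R by lra.
    by rewrite mulrDr mulrA s1; ring.
Qed.

(** * Existence of a triple point *)

(** A finite index type for the integers from -N to N allows finitely many neighbourhoods to be
    intersected. *)
Lemma lattice_point_bound (R : realType) (K : R) :
  exists N : nat, forall m : int, `|m%:~R| <= K -> exists i : 'I_N.*2.+1, m = i%:Z - N%:Z.
Proof.
exists (Num.truncn K).+1 => m hm.
have hK : K < (Num.truncn K).+1%:R by exact: truncnS_gt.
have hm' : `|m| <= (Num.truncn K).+1%:Z.
  by rewrite -(ler_int R) intr_norm; apply: (le_trans hm); exact: ltW.
have hi : (`|(m + (Num.truncn K).+1%:Z)%R| < ((Num.truncn K).+1).*2.+1)%N by lia.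
by exists (Ordinal hi) => /=; lia.
Qed.

(** Only finitely many translates come near p, and each closed translate that misses p misses a
    neighbourhood of p. *)
Lemma locally_finite_tiles (R : realType) (F : R -> R -> Prop) (M p1 p2 : R) :
  closed2 F -> (forall x y, F x y -> `|x| <= M /\ `|y| <= M) ->
  exists2 e : R, 0 < e & forall (m n : int) x y, `|x - p1| < e -> `|y - p2| < e ->
    F (x - m%:~R) (y - n%:~R) -> F (p1 - m%:~R) (p2 - n%:~R).
Proof.
move=> kF bF.
have [N hN] := lattice_point_bound _ (`|p1| + `|p2| + 1 + M).
pose zm (i : 'I_N.*2.+1) : R := (i%:Z - N%:Z)%:~R.
pose near_tile (i : 'I_N.*2.+1 * 'I_N.*2.+1) (s : R * R) :=
  F (s.1 - zm i.1) (s.2 - zm i.2) -> F (p1 - zm i.1) (p2 - zm i.2).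
have : \forall s \near nbhs ((p1, p2) : R * R), forall i, near_tile i s.
  apply: (filter_forall (nbhs_filter _)) => i.
  have [h|h] := pselect (F (p1 - zm i.1) (p2 - zm i.2)).
    by apply: (filterS _ (@filterT _ (nbhs (p1, p2)) _)) => s _ _.
  have [e e0 he] := closed2_far _ _ _ _ (closed2_shift _ _ (zm i.1) (zm i.2) kF) h.
  apply/nbhs_ballP; exists e => //= s [/= h1 h2] Fs; exfalso.
  by apply: (he s.1 s.2) => //; rewrite distrC.
move=> /nbhs_ballP[e /= e0 he].
exists (Num.min e 1); first by rewrite lt_min e0 ltr01.
move=> m n x y; rewrite !lt_min => /andP[hx hx1] /andP[hy hy1] Fmn.
have [bx by_] := bF _ _ Fmn.
have n1 := normr_ge0 p1; have n2 := normr_ge0 p2.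
have bm (k : int) (z p : R) : `|z - k%:~R| <= M -> `|z - p| < 1 ->
    `|p| <= `|p1| + `|p2| -> `|k%:~R : R| <= `|p1| + `|p2| + 1 + M.
  move=> h1 h2 h3; rewrite (_ : k%:~R = p + (z - p) - (z - k%:~R)); last by ring.
  apply: (le_trans (ler_normB _ _)); apply: lerD => //.
  apply: (le_trans (ler_normD _ _)); lra.
have [i ei] : exists i : 'I_N.*2.+1, m = i%:Z - N%:Z
  by apply: hN; apply: (bm m x p1); lra.
have [j ej] : exists j : 'I_N.*2.+1, n = j%:Z - N%:Z
  by apply: hN; apply: (bm n y p2); lra.
rewrite ei ej in Fmn *; apply: (he (x, y) _ (i, j)) => //.
by split; rewrite /ball /= distrC.
Qed.

(** The slanted sides have direction (-k, 1), which for k = 2 * p2 is tangent at p to the level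
    curve of x + y^2. *)
Lemma convex2_parallelogram (R : realType) (F : R -> R -> Prop) (p1 p2 k a b s t : R) :
  convex2 F -> 0 < a -> 0 < b ->
  F (p1 + k * b + a) (p2 - b) -> F (p1 + k * b - a) (p2 - b) ->
  F (p1 - k * b + a) (p2 + b) -> F (p1 - k * b - a) (p2 + b) ->
  `|s| <= a -> `|t| <= b -> F (p1 - k * t + s) (p2 + t).
Proof.
move=> cF a0 b0 F1 F2 F3 F4; rewrite !ler_norml => hs ht.
pose r := (a + s) / (2 * a); pose q := (b + t) / (2 * b).
have hr : 0 <= r <= 1 by rewrite /r divr_ge0 ?ler_pdivrMr; lra.
have hq : 0 <= q <= 1 by rewrite /q divr_ge0 ?ler_pdivrMr; lra.
have es : s = 2 * a * r - a by rewrite /r; field; lra.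
have et : t = 2 * b * q - b by rewrite /q; field; lra.
apply: (convex2_eq _ _ q _ _ _ _ _ _ cF (cF _ _ _ _ r F2 F1 hr) (cF _ _ _ _ r F4 F3 hr) hq);
  rewrite ?es ?et; ring.
Qed.

(* Let p maximize x + y^2 on F.  The points near p with a larger value of x + y^2 belong
   to other tiles, and since this function is strictly convex along the tangent of its
   level curve, p is in the interior of their convex hull: if they all belonged to a single
   tile, it would overlap F. *)
Lemma triple_point (R : realType) (F : R -> R -> Prop) (M : R) :
  convex2 F -> closed2 F -> (forall x y, F x y -> `|x| <= M /\ `|y| <= M) ->
  covering2 F -> packing2 F ->
  exists p1 p2, exists u1 u2 v1 v2 : int,
    [/\ (u1, u2) != (0, 0), (v1, v2) != (0, 0) & (u1, u2) != (v1, v2)] /\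
    [/\ F p1 p2, F (p1 - u1%:~R) (p2 - u2%:~R) & F (p1 - v1%:~R) (p2 - v2%:~R)].
Proof.
move=> cF kF bF vF pF.
have [m0 [n0 F0]] := vF 0 0.
pose f (s : R * R) := s.1 + s.2 * s.2.
have cf : continuous f.
  move=> s; apply: cvgD; first exact: cvg_fst.
  by apply: cvgM; exact: cvg_snd.
have [p1 [p2 [Fp pmax]]] := closed2_argmax _ _ _ _ _ _ kF bF cf F0.
have [e e0 he] := locally_finite_tiles _ _ _ p1 p2 kF bF.
have tile (x y : R) : `|x - p1| < e -> `|y - p2| < e -> f (p1, p2) < f (x, y) ->
    exists u1 u2 : int, [/\ (u1, u2) != (0, 0), F (p1 - u1%:~R) (p2 - u2%:~R)
      & F (x - u1%:~R) (y - u2%:~R)].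
  move=> hx hy hf; have [m [n Fmn]] := vF x y; exists m, n; split=> //.
    apply/eqP => -[m00 n00]; move: Fmn; rewrite m00 n00 !subr0 => /pmax.
    by rewrite leNgt hf.
  exact: he hx hy Fmn.
have [t [t0 t1 te]] : exists t : R, [/\ 0 < t, t <= 1 & t * (2 * `|p2| + 1) < e].
  have np : 0 < 2 * (2 * `|p2| + 1) by have := normr_ge0 p2; lra.
  exists (Num.min 1 (e / (2 * (2 * `|p2| + 1)))); split.
  - by rewrite lt_min ltr01 divr_gt0.
  - by rewrite ge_min lexx.
  - have h : Num.min 1 (e / (2 * (2 * `|p2| + 1))) <= e / (2 * (2 * `|p2| + 1)).
      by rewrite ge_min lexx orbT.
    move: h; rewrite ler_pdivlMr //; lra.
(* At p + (s - 2 * p2 * r, r) the function x + y^2 exceeds its value at p by exactly s + r^2, which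
   is at least t^2 / 2 when |s| = a and |r| = t. *)
pose a := t ^+ 2 / 2.
have a0 : 0 < a by rewrite divr_gt0 ?exprn_gt0.
have ta : a <= t / 2 by rewrite /a; nra.
have corner (s r : R) : `|s| = a -> `|r| = t -> exists u1 u2 : int,
    [/\ (u1, u2) != (0, 0), F (p1 - u1%:~R) (p2 - u2%:~R)
      & F (p1 - 2 * p2 * r + s - u1%:~R) (p2 + r - u2%:~R)].
  move=> hs hr; have np := normr_ge0 p2; apply: tile.
  - rewrite (_ : _ - p1 = s - 2 * p2 * r); last by ring.
    apply: (le_lt_trans (ler_normB _ _)); rewrite !normrM hs hr ger0_norm //; lra.
  - by rewrite (_ : _ - p2 = r) ?hr; [nra | ring].
  - have r2 : r ^+ 2 = t ^+ 2 by rewrite -[r ^+ 2]real_normK ?num_real // hr.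
    have /andP[sa _] : - a <= s <= a by rewrite -ler_norml hs.
    rewrite /f /=.
    have -> : p1 - 2 * p2 * r + s + (p2 + r) * (p2 + r) = p1 + p2 * p2 + (s + r ^+ 2).
      by ring.
    by rewrite r2 ltrDl; move: sa a0; rewrite /a; lra.
have na : `|a| = a by rewrite gtr0_norm.
have nt : `|t| = t by rewrite gtr0_norm.
have nNa : `|- a| = a by rewrite normrN.
have nNt : `|- t| = t by rewrite normrN.
have [u1 [u2 [u0 Fu FA]]] := corner a (- t) na nNt.
have [v1 [v2 [v0 Fv FB]]] := corner (- a) (- t) nNa nNt.
have [w1 [w2 [w0 Fw FC]]] := corner a t na nt.
have [z1 [z2 [z0 Fz FD]]] := corner (- a) t nNa nt.
(* Two corners in different tiles give the triple point, since both tiles contain p. Otherwise one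
   tile contains the whole parallelogram around p. *)
have [/eqP[e1 e2]|uv] := boolP ((v1, v2) == (u1, u2)); last first.
  by exists p1, p2, v1, v2, u1, u2.
have [/eqP[e3 e4]|uw] := boolP ((w1, w2) == (u1, u2)); last first.
  by exists p1, p2, w1, w2, u1, u2.
have [/eqP[e5 e6]|uz] := boolP ((z1, z2) == (u1, u2)); last first.
  by exists p1, p2, z1, z2, u1, u2.
subst v1 v2 w1 w2 z1 z2; exfalso.
pose G x y := F (x - u1%:~R) (y - u2%:~R).
have cG : convex2 G.
  move=> x y x' y' r h1 h2 hr.
  by apply: (convex2_eq _ _ r _ _ _ _ _ _ cF h1 h2 hr); ring.
have np : 0 < 2 * `|p2| + 1 by have := normr_ge0 p2; lra.
pose d := a / (2 * `|p2| + 1).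
have d0 : 0 < d by rewrite divr_gt0.
have ed : d * (2 * `|p2| + 1) = a by rewrite divfK // gt_eqF.
have boxG : box_in G p1 p2 d.
  move=> x y hx hy.
  have := convex2_parallelogram _ _ p1 p2 (2 * p2) a t
    (x - p1 + 2 * p2 * (y - p2)) (y - p2) cG a0 t0.
  rewrite (_ : p1 - _ * (y - p2) + _ = x); last by ring.
  rewrite (_ : p2 + (y - p2) = y); last by ring.
  apply=> //.
  - by move: FA; rewrite /G mulrN opprK.
  - by move: FB; rewrite /G mulrN opprK.
  - apply: (le_trans (ler_normD _ _)); rewrite !normrM [`|2|]ger0_norm //.
    by have := normr_ge0 p2; nra.
  - apply: (le_trans (ltW hy)); have := normr_ge0 p2; nra.
(* A box of F shrunk far enough towards p fits into the box of G around p, against the packing. *)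
have [c1 [c2 [r r0 bFr]]] := interior_nonempty _ _ cF vF.
have nc1 := normr_ge0 (c1 - p1); have nc2 := normr_ge0 (c2 - p2).
pose K := `|c1 - p1| + `|c2 - p2| + r.
pose q := Num.min 1 (d / (2 * K)).
have q1 : q <= 1 by rewrite ge_min lexx.
have K0 : 0 < K by rewrite /K; lra.
have q0 : 0 < q by rewrite lt_min ltr01 divr_gt0 // mulr_gt0.
have qK : q * K < d.
  have : q <= d / (2 * K) by rewrite ge_min lexx orbT.
  by rewrite ler_pdivlMr; lra.
have hq : 0 < q <= 1 by rewrite q0.
have near_p (x p c : R) : `|x - ((1 - q) * p + q * c)| < q * r ->
    `|c - p| <= `|c1 - p1| + `|c2 - p2| -> `|x - p| < d.
  move=> h1 h2; rewrite (_ : x - p = x - ((1 - q) * p + q * c) + q * (c - p)); last by ring.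
  apply: (le_lt_trans (ler_normD _ _)); rewrite normrM (gtr0_norm q0).
  by move: qK; rewrite /K; nra.
have := pF u1 u2 ((1 - q) * p1 + q * c1) ((1 - q) * p2 + q * c2) (q * r).
case=> [||x y hx hy|e1 e2].
- exact: mulr_gt0.
- exact: box_in_shrink.
- by apply: boxG; [apply: (near_p x p1 c1 hx) | apply: (near_p y p2 c2 hy)]; lra.
- by rewrite e1 e2 eqxx in u0.
Qed.

(** * Neighbours in the second tiling *)

(* A difference of two points of the triangle -1 <= x, -1 <= y, x + y <= 0 that is neither
   a vertex of the hexagon nor twice a lattice point is extremal in two directions, which
   forces a corner of the triangle into F. *)
Lemma neighbour_cases (R : realType) (F : R -> R -> Prop) (m n : int) :
  no_stretched_lattice F ->
  (forall x y, F x y -> [/\ -1 <= x, -1 <= y & x + y <= 0]) ->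
  (m, n) != (0, 0) -> diff2 F m%:~R n%:~R ->
  [\/ (m, n) \in [:: (1, 0); (-1, 0); (0, 1); (0, -1); (1, -1); (-1, 1)],
      (m, n) \in [:: (1, 1); (-1, -1)] /\ F (-1) (-1),
      (m, n) \in [:: (2, -1); (-2, 1)] /\ F 1 (-1) |
      (m, n) \in [:: (1, -2); (-1, 2)] /\ F (-1) 1].
Proof.
move=> nF bF mn0 Dmn.
have hm : (m%:~R : R) = 2 * (m%:~R / 2) by field.
have hn : (n%:~R : R) = 2 * (n%:~R / 2) by field.
have not_double (k l : int) : m = 2 * k -> n = 2 * l -> False.
  move=> em en; have [||k0 l0] := nF k l 2; first lra.
    by move: Dmn; rewrite em en !rmorphM.
  by rewrite em en k0 l0 eqxx in mn0.
case: (Dmn) => a [b [a' [b' [Fab Fab' e1 e2]]]].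
have [h1 h2 h3] := bF _ _ Fab; have [h4 h5 h6] := bF _ _ Fab'.
have intr2 : (2%:~R : R) = 2 by [].
have le2 (k : int) : -2 <= (k%:~R : R) <= 2 -> -2 <= k <= 2.
  by rewrite -{1 2}intr2 -rmorphN !ler_int.
have hm2 : -2 <= m <= 2 by apply: le2; lra.
have hn2 : -2 <= n <= 2 by apply: le2; lra.
have hmn2 : -2 <= m + n <= 2 by apply: le2; rewrite rmorphD /=; lra.
have corner (x y : R) : (x = a /\ y = b) \/ (x = a' /\ y = b') -> F x y.
  by case=> -[-> ->].
have five (k : int) : -2 <= k <= 2 -> k = -2 \/ k = -1 \/ k = 0 \/ k = 1 \/ k = 2.
  by lia.
clear Dmn hm hn le2.
(* Besides the hexagon vertices and the doubled ones, the bounds leave six vectors, each attained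
   only with a corner of the triangle as one of the two points. *)
have [em|[em|[em|[em|em]]]] := five m hm2; have [en|[en|[en|[en|en]]]] := five n hn2;
  subst m n;
  first [ by [] | by constructor 1 | by case: (not_double 1 0) | by case: (not_double (-1) 0)
        | by case: (not_double 0 1) | by case: (not_double 0 (-1))
        | by case: (not_double 1 (-1)) | by case: (not_double (-1) 1)
        | rewrite ?rmorphN ?rmorph1 /= ?intr2 in e1 e2 ].
- by constructor 3; split=> //; apply: corner; right; lra.
- by constructor 2; split=> //; apply: corner; left; lra.
- by constructor 4; split=> //; apply: corner; left; lra.
- by constructor 4; split=> //; apply: corner; right; lra.
- by constructor 2; split=> //; apply: corner; right; lra.
- by constructor 3; split=> //; apply: corner; left; lra.
Qed.

Ltac lattice_witness k m n :=
  solve [exists k, m, n; split; first [assumption | by auto]].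

(** By [neighbour_cases] there are finitely many possible u, v and u - v. In each case p can be
    taken among the six known hexagon points and the corner of the triangle that may belong to F. *)
Lemma triple_point_of_neighbours (R : realType) (F : R -> R -> Prop)
    (d1 d2 : R) (u1 u2 v1 v2 : int) :
  no_stretched_lattice F ->
  (forall x y, F x y -> [/\ -1 <= x, -1 <= y & x + y <= 0]) ->
  F 0 0 -> F (-1) 0 -> F 0 (-1) ->
  F (d1 - 1) d2 -> F d1 (d2 - 1) -> F (d1 - 1) (d2 - 1) ->
  (u1, u2) != (0, 0) -> (v1, v2) != (0, 0) -> (u1, u2) != (v1, v2) ->
  diff2 F u1%:~R u2%:~R -> diff2 F v1%:~R v2%:~R ->
  diff2 F (u1%:~R - v1%:~R) (u2%:~R - v2%:~R) ->
  exists p1 p2, [/\ F p1 p2, F (p1 - u1%:~R) (p2 - u2%:~R) &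
    F (p1 - v1%:~R) (p2 - v2%:~R)].
Proof.
move=> nF bF F00 F10 F01 Fd1 Fd2 Fd12 u0 v0 uv Du Dv Duv.
pose G (k : bool) (m n : int) := F (k%:R * d1 + m%:~R) (k%:R * d2 + n%:~R).
suff [k [m [n [G1 G2 G3]]]] : exists k (m n : int),
    [/\ G k m n, G k (m - u1) (n - u2) & G k (m - v1) (n - v2)].
  exists (k%:R * d1 + m%:~R), (k%:R * d2 + n%:~R).
  by split=> //; rewrite -!addrA -!intrB.
have Feq (k : bool) (m n : int) (x y : R) :
    F x y -> x = k%:R * d1 + m%:~R -> y = k%:R * d2 + n%:~R ->
  G k m n by rewrite /G => ? <- <-.
have cast := (rmorphN, rmorph1, rmorph0, mul0r, mul1r, add0r, addr0).
have G00 : G false 0 0 by apply: (Feq _ _ _ _ _ F00); rewrite ?cast.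
have G10 : G false (-1) 0 by apply: (Feq _ _ _ _ _ F10); rewrite ?cast.
have G01 : G false 0 (-1) by apply: (Feq _ _ _ _ _ F01); rewrite ?cast.
have Gd1 : G true (-1) 0 by apply: (Feq _ _ _ _ _ Fd1); rewrite ?cast.
have Gd2 : G true 0 (-1) by apply: (Feq _ _ _ _ _ Fd2); rewrite ?cast.
have Gd12 : G true (-1) (-1) by apply: (Feq _ _ _ _ _ Fd12); rewrite ?cast.
(* Two corners of the triangle differ by twice a nonzero lattice vector, so F contains at most one
   of them. *)
have corner12 : F (-1) (-1) -> F 1 (-1) -> False.
  move=> h1 h2; have [||e _] := nF 1 0 2; [lra | | by []].
  by exists 1, (-1), (-1), (-1); split=> //; rewrite ?cast; ring.
have corner13 : F (-1) (-1) -> F (-1) 1 -> False.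
  move=> h1 h2; have [||_ e] := nF 0 1 2; [lra | | by []].
  by exists (-1), 1, (-1), (-1); split=> //; rewrite ?cast; ring.
have corner23 : F 1 (-1) -> F (-1) 1 -> False.
  move=> h1 h2; have [||e _] := nF 1 (-1) 2; [lra | | by []].
  by exists 1, (-1), (-1), 1; split=> //; rewrite ?cast; ring.
have corner1 : F (-1) (-1) -> G false (-1) (-1).
  by move=> h; apply: (Feq _ _ _ _ _ h); rewrite ?cast.
have corner2 : F 1 (-1) -> G false 1 (-1).
  by move=> h; apply: (Feq _ _ _ _ _ h); rewrite ?cast.
have corner3 : F (-1) 1 -> G false (-1) 1.
  by move=> h; apply: (Feq _ _ _ _ _ h); rewrite ?cast.
have uv0 : (u1 - v1, u2 - v2) != (0, 0).
  by apply: contra uv => /eqP[/subr0_eq -> /subr0_eq ->].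
rewrite -!intrB in Duv.
have := neighbour_cases _ _ _ _ nF bF u0 Du.
have := neighbour_cases _ _ _ _ nF bF v0 Dv.
have := neighbour_cases _ _ _ _ nF bF uv0 Duv.
(* With G abstract, only integer data remain: a finite search in which candidates for p are tried in
   turn and cases with two different corners are contradictory. *)
clearbody G; clear - corner12 corner13 corner23 corner1 corner2 corner3 G00 G10 G01 Gd1 Gd2 Gd12.
move=> hw hv hu.
case: hu => [|[+ hu]|[+ hu]|[+ hu]]; rewrite !inE; repeat case/orP;
    move=> /eqP[? ?]; subst u1 u2;
  case: hv => [|[+ hv]|[+ hv]|[+ hv]]; rewrite !inE; repeat case/orP;
    move=> /eqP[? ?]; subst v1 v2;
  case: hw => [|[+ hw]|[+ hw]|[+ hw]]; try by []; move=> _;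
  first [ lattice_witness false 0%Z 0%Z | lattice_witness false (-1)%Z 0%Z
        | lattice_witness false 0%Z (-1)%Z | lattice_witness true (-1)%Z 0%Z
        | lattice_witness true 0%Z (-1)%Z | lattice_witness true (-1)%Z (-1)%Z
        | lattice_witness false (-1)%Z (-1)%Z | lattice_witness false 1%Z (-1)%Z
        | lattice_witness false (-1)%Z 1%Z | by exfalso; auto ].
Qed.

(** * Change of lattice basis and the common basis *)

Definition lattice_tile {R : realType} (F : R -> R -> Prop) : Prop :=
  [/\ convex2 F, closed2 F, covering2 F & no_stretched_lattice F].

Definition in_basis {R : realType} (F : R -> R -> Prop) (p1 p2 : R)
    (u1 u2 v1 v2 : int) (x y : R) : Prop :=
  F (p1 + x * u1%:~R + y * v1%:~R) (p2 + x * u2%:~R + y * v2%:~R).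

(** Cramer's rule without division, the determinant being its own inverse; this serves both the
    integers and the reals. *)
Lemma basis_coordinates (Z : comNzRingType) (u1 u2 v1 v2 x y : Z) :
  (u1 * v2 - u2 * v1) * (u1 * v2 - u2 * v1) = 1 ->
  exists a b, x = a * u1 + b * v1 /\ y = a * u2 + b * v2.
Proof.
set d := u1 * v2 - u2 * v1 => dd.
exists (d * (x * v2 - y * v1)), (d * (u1 * y - u2 * x)).
by split; rewrite -[LHS]mul1r -dd /d; ring.
Qed.

Lemma lattice_tile_in_basis (R : realType) (F : R -> R -> Prop) (p1 p2 : R)
    (u1 u2 v1 v2 : int) :
  (u1 * v2 - u2 * v1) * (u1 * v2 - u2 * v1) = 1 ->
  lattice_tile F -> lattice_tile (in_basis F p1 p2 u1 u2 v1 v2).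
Proof.
move=> dd [cF kF vF nF].
have ddR : ((u1%:~R * v2%:~R - u2%:~R * v1%:~R) *
    (u1%:~R * v2%:~R - u2%:~R * v1%:~R) : R) = 1.
  by rewrite -!intrM -intrB -intrM dd.
split.
- move=> x y x' y' t h1 h2 ht.
  by apply: (convex2_eq _ _ t _ _ _ _ _ _ cF h1 h2 ht); ring.
- apply: (@preimage_closed _ _ (fun s : R * R =>
    (p1 + s.1 * u1%:~R + s.2 * v1%:~R, p2 + s.1 * u2%:~R + s.2 * v2%:~R)) _ _ kF).
  have affine (p a b : R) : continuous (fun s : R * R => p + s.1 * a + s.2 * b).
    move=> s; apply: cvgD; first apply: cvgD.
    + exact: cvg_cst.
    + by apply: cvgM; [exact: cvg_fst | exact: cvg_cst].
    + by apply: cvgM; [exact: cvg_snd | exact: cvg_cst].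
  by move=> s _; apply: continuous_pair; exact: affine.
- move=> x y.
  have [m [n Fmn]] := vF (p1 + x * u1%:~R + y * v1%:~R) (p2 + x * u2%:~R + y * v2%:~R).
  have [a [b [em en]]] := basis_coordinates _ u1 u2 v1 v2 m n dd.
  exists a, b; rewrite /in_basis.
  move: Fmn; rewrite em en !rmorphD !rmorphM /= => Fmn.
  by apply: (pred2_eq _ _ _ _ _ _ Fmn); ring.
- move=> m n t t1 [a [b [a' [b' [h1 h2 e1 e2]]]]].
  have [e3 e4] : m * u1 + n * v1 = 0 /\ m * u2 + n * v2 = 0.
    apply: (nF _ _ t t1); rewrite !rmorphD !rmorphM /=.
    eexists; eexists; eexists; eexists; split; [exact: h1 | exact: h2 | |].
    + have -> : a = a' + t * m%:~R by lra.
      have -> : b = b' + t * n%:~R by lra.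
      by ring.
    + have -> : a = a' + t * m%:~R by lra.
      have -> : b = b' + t * n%:~R by lra.
      by ring.
  split.
    rewrite -[m]mul1r -dd.
    rewrite (_ : _ * m = (u1 * v2 - u2 * v1) *
      ((m * u1 + n * v1) * v2 - (m * u2 + n * v2) * v1)); last by ring.
    by rewrite e3 e4 !mul0r subrr mulr0.
  rewrite -[n]mul1r -dd.
  rewrite (_ : _ * n = (u1 * v2 - u2 * v1) *
    ((m * u2 + n * v2) * u1 - (m * u1 + n * v1) * u2)); last by ring.
  by rewrite e3 e4 !mul0r subrr mulr0.
Qed.

(* G contains the hexagon p, p - e1, p - e2, q - e1, q - e2, q - e1 - e2 with p = 0, q = d
   and lies in the lattice-free triangle. *)
Definition hexagonal {R : realType} (G : R -> R -> Prop) : Prop :=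
  [/\ [/\ G 0 0, G (-1) 0 & G 0 (-1)],
      forall x y, G x y -> [/\ -1 <= x, -1 <= y & x + y <= 0] &
      exists d1 d2, [/\ 0 <= d1, 0 <= d2 & d1 + d2 <= 1] /\
        [/\ G (d1 - 1) d2, G d1 (d2 - 1) & G (d1 - 1) (d2 - 1)]].

Lemma hexagonal_in_basis (R : realType) (F : R -> R -> Prop) (p1 p2 : R)
    (u1 u2 v1 v2 : int) :
  lattice_tile F -> (u1 * v2 - u2 * v1) * (u1 * v2 - u2 * v1) = 1 ->
  F p1 p2 -> F (p1 - u1%:~R) (p2 - u2%:~R) -> F (p1 - v1%:~R) (p2 - v2%:~R) ->
  hexagonal (in_basis F p1 p2 u1 u2 v1 v2).
Proof.
move=> tF dd Fp Fu Fv.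
have [cG kG vG nG] := lattice_tile_in_basis _ _ p1 p2 _ _ _ _ dd tF.
have G00 : in_basis F p1 p2 u1 u2 v1 v2 0 0 by rewrite /in_basis !mul0r !addr0.
have G10 : in_basis F p1 p2 u1 u2 v1 v2 (-1) 0.
  by rewrite /in_basis !mul0r !addr0 !mulN1r.
have G01 : in_basis F p1 p2 u1 u2 v1 v2 0 (-1).
  by rewrite /in_basis !mul0r !addr0 !mulN1r.
have bG := triangle_bound _ _ _ _ cG nG G00 G10 G01.
by split=> //; exact: opposite_triple_point.
Qed.

(** The basis u, v comes from a triple point of F1. A basis w, z from a triple point of F2 makes F2
    hexagonal; in these coordinates u, v and u - v are neighbours of 0, which yields a triple point
    of F2 with the same u and v. *)
Lemma common_hexagonal_basis (R : realType) (F1 F2 : R -> R -> Prop) (M1 M2 : R) :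
  lattice_tile F1 -> packing2 F1 -> (forall x y, F1 x y -> `|x| <= M1 /\ `|y| <= M1) ->
  lattice_tile F2 -> packing2 F2 -> (forall x y, F2 x y -> `|x| <= M2 /\ `|y| <= M2) ->
  (forall m n : int, diff2 F1 m%:~R n%:~R -> diff2 F2 m%:~R n%:~R) ->
  exists u1 u2 v1 v2 : int, (u1 * v2 - u2 * v1) * (u1 * v2 - u2 * v1) = 1 /\
    exists p1 p2 q1 q2, hexagonal (in_basis F1 p1 p2 u1 u2 v1 v2) /\
      hexagonal (in_basis F2 q1 q2 u1 u2 v1 v2).
Proof.
move=> t1 k1 b1 t2 k2 b2 F12.
have [cF1 kF1 vF1 nF1] := t1; have [cF2 kF2 vF2 nF2] := t2.
have [p1 [p2 [u1 [u2 [v1 [v2 [[u0 v0 uv] [Fp Fu Fv]]]]]]]] :=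
  triple_point _ _ _ cF1 kF1 b1 vF1 k1.
have dd := lattice_basis _ _ _ _ _ _ _ _ cF1 nF1 Fp Fu Fv u0 v0 uv.
exists u1, u2, v1, v2; split=> //; exists p1, p2.
have [q1 [q2 [w1 [w2 [z1 [z2 [[w0 z0 wz] [Fq Fw Fz]]]]]]]] :=
  triple_point _ _ _ cF2 kF2 b2 vF2 k2.
have dd' := lattice_basis _ _ _ _ _ _ _ _ cF2 nF2 Fq Fw Fz w0 z0 wz.
have [_ _ _ nG] := lattice_tile_in_basis _ _ q1 q2 _ _ _ _ dd' t2.
have [[G00 G10 G01] bG [d1 [d2 [_ [Gd1 Gd2 Gd12]]]]] :=
  hexagonal_in_basis _ _ _ _ _ _ _ _ t2 dd' Fq Fw Fz.
have [a1 [a2 [eu1 eu2]]] := basis_coordinates _ _ _ _ _ u1 u2 dd'.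
have [b1' [b2' [ev1 ev2]]] := basis_coordinates _ _ _ _ _ v1 v2 dd'.
have ddR : ((w1%:~R * z2%:~R - w2%:~R * z1%:~R) *
    (w1%:~R * z2%:~R - w2%:~R * z1%:~R) : R) = 1.
  by rewrite -!intrM -intrB -intrM dd'.
have diffG (m n k l : int) : diff2 F1 m%:~R n%:~R ->
    m = k * w1 + l * z1 -> n = k * w2 + l * z2 ->
    diff2 (in_basis F2 q1 q2 w1 w2 z1 z2) k%:~R l%:~R.
  move=> /F12[a [b [a' [b' [h1 h2 e1 e2]]]]] em en.
  have [x [y [ex ey]]] := basis_coordinates _ _ _ _ _ (a' - q1) (b' - q2) ddR.
  have {}ex : a' = q1 + x * w1%:~R + y * z1%:~R by lra.
  have {}ey : b' = q2 + x * w2%:~R + y * z2%:~R by lra.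
  exists (x + k%:~R), (y + l%:~R), x, y; split; [| | ring | ring].
  - rewrite /in_basis.
    have ea : a = q1 + (x + k%:~R) * w1%:~R + (y + l%:~R) * z1%:~R.
      by move: e1; rewrite em rmorphD !rmorphM /= ex; lra.
    have eb : b = q2 + (x + k%:~R) * w2%:~R + (y + l%:~R) * z2%:~R.
      by move: e2; rewrite en rmorphD !rmorphM /= ey; lra.
    by rewrite -ea -eb.
  - by rewrite /in_basis -ex -ey.
have Du : diff2 F1 u1%:~R u2%:~R.
  by exists p1, p2, (p1 - u1%:~R), (p2 - u2%:~R); split=> //; ring.
have Dv : diff2 F1 v1%:~R v2%:~R.
  by exists p1, p2, (p1 - v1%:~R), (p2 - v2%:~R); split=> //; ring.
have Duv : diff2 F1 (u1 - v1)%:~R (u2 - v2)%:~R.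
  exists (p1 - v1%:~R), (p2 - v2%:~R), (p1 - u1%:~R), (p2 - u2%:~R).
  by rewrite !rmorphB /=; split=> //; ring.
have DuG := diffG _ _ a1 a2 Du eu1 eu2.
have DvG := diffG _ _ b1' b2' Dv ev1 ev2.
have DuvG : diff2 (in_basis F2 q1 q2 w1 w2 z1 z2)
    (a1%:~R - b1'%:~R) (a2%:~R - b2'%:~R).
  rewrite -!rmorphB; apply: (diffG _ _ _ _ Duv).
    by rewrite {1}eu1 {1}ev1; ring.
  by rewrite {1}eu2 {1}ev2; ring.
have a0 : (a1, a2) != (0, 0).
  by apply: contra u0 => /eqP[h1 h2]; rewrite eu1 eu2 h1 h2 !mul0r addr0.
have b0 : (b1', b2') != (0, 0).
  by apply: contra v0 => /eqP[h1 h2]; rewrite ev1 ev2 h1 h2 !mul0r addr0.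
have ab : (a1, a2) != (b1', b2').
  by apply: contra uv => /eqP[h1 h2]; rewrite eu1 eu2 ev1 ev2 h1 h2.
have [x [y [Gp Gu Gv]]] := triple_point_of_neighbours _ _ _ _ _ _ _ _
  nG bG G00 G10 G01 Gd1 Gd2 Gd12 a0 b0 ab DuG DvG DuvG.
exists (q1 + x * w1%:~R + y * z1%:~R), (q2 + x * w2%:~R + y * z2%:~R).
split; first exact: hexagonal_in_basis.
apply: hexagonal_in_basis => //.
- move: Gu; rewrite /in_basis eu1 eu2 !rmorphD !rmorphM /= => Gu.
  by apply: (pred2_eq _ _ _ _ _ _ Gu); ring.
- move: Gv; rewrite /in_basis ev1 ev2 !rmorphD !rmorphM /= => Gv.
  by apply: (pred2_eq _ _ _ _ _ _ Gv); ring.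
Qed.

(** * Convex combinations of two hexagonal tiles *)

Definition mix2 {R : realType} (lam : R) (F1 F2 : R -> R -> Prop) (x y : R) : Prop :=
  exists a b a' b', [/\ F1 a b, F2 a' b',
    x = (1 - lam) * a + lam * a' & y = (1 - lam) * b + lam * b'].

Lemma convex2_mix2 (R : realType) (lam : R) (F1 F2 : R -> R -> Prop) :
  convex2 F1 -> convex2 F2 -> convex2 (mix2 lam F1 F2).
Proof.
move=> c1 c2 x y x' y' t [a [b [a' [b' [h1 h2 -> ->]]]]].
move=> [c [d [c' [d' [h3 h4 -> ->]]]]] ht.
exists ((1 - t) * a + t * c), ((1 - t) * b + t * d).
exists ((1 - t) * a' + t * c'), ((1 - t) * b' + t * d').
by split; [exact: c1 | exact: c2 | ring | ring].
Qed.

(** The six hexagon points are fixed lattice shifts of 0 and d, so mixing them pairwise gives the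
    hexagon of the mixed d. *)
Lemma hexagonal_mix_covers (R : realType) (lam : R) (G1 G2 : R -> R -> Prop) :
  convex2 G1 -> convex2 G2 -> hexagonal G1 -> hexagonal G2 -> 0 <= lam <= 1 ->
  covering2 (mix2 lam G1 G2).
Proof.
move=> cG1 cG2 [[A00 A10 A01] _ [d1 [d2 [[h1 h2 h12] [A1 A2 A12]]]]].
move=> [[B00 B10 B01] _ [e1 [e2 [[k1 k2 k12] [B1 B2 B12]]]]] hlam x y.
apply: (hexagon_covers _ _ ((1 - lam) * d1 + lam * e1) ((1 - lam) * d2 + lam * e2)).
- exact: convex2_mix2.
- by exists 0, 0, 0, 0; split=> //; ring.
- by exists (-1), 0, (-1), 0; split=> //; ring.
- by exists 0, (-1), 0, (-1); split=> //; ring.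
- by nra.
- by nra.
- by nra.
- by exists (d1 - 1), d2, (e1 - 1), e2; split=> //; ring.
- by exists d1, (d2 - 1), e1, (e2 - 1); split=> //; ring.
- by exists (d1 - 1), (d2 - 1), (e1 - 1), (e2 - 1); split=> //; ring.
Qed.

Lemma mix2_covers (R : realType) (lam p1 p2 q1 q2 : R) (u1 u2 v1 v2 : int)
    (F1 F2 : R -> R -> Prop) :
  (u1 * v2 - u2 * v1) * (u1 * v2 - u2 * v1) = 1 ->
  lattice_tile F1 -> lattice_tile F2 ->
  hexagonal (in_basis F1 p1 p2 u1 u2 v1 v2) ->
  hexagonal (in_basis F2 q1 q2 u1 u2 v1 v2) -> 0 <= lam <= 1 ->
  covering2 (mix2 lam F1 F2).
Proof.
move=> dd t1 t2 H1 H2 hlam x y.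
have [c1 _ _ _] := lattice_tile_in_basis _ _ p1 p2 _ _ _ _ dd t1.
have [c2 _ _ _] := lattice_tile_in_basis _ _ q1 q2 _ _ _ _ dd t2.
have ddR : ((u1%:~R * v2%:~R - u2%:~R * v1%:~R) *
    (u1%:~R * v2%:~R - u2%:~R * v1%:~R) : R) = 1.
  by rewrite -!intrM -intrB -intrM dd.
have [s [t [es et]]] := basis_coordinates _ _ _ _ _
  (x - ((1 - lam) * p1 + lam * q1)) (y - ((1 - lam) * p2 + lam * q2)) ddR.
have [m [n [a [b [a' [b' [h1 h2 e1 e2]]]]]]] :=
  hexagonal_mix_covers _ _ _ _ c1 c2 H1 H2 hlam s t.
exists (m * u1 + n * v1), (m * u2 + n * v2).
have es' : s = m%:~R + ((1 - lam) * a + lam * a') by lra.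
have et' : t = n%:~R + ((1 - lam) * b + lam * b') by lra.
rewrite es' et' in es et.
do 4! eexists; split; [exact: h1 | exact: h2 | |]; rewrite !rmorphD !rmorphM /=; lra.
Qed.

(** In the coordinates of u, v centred at mu times the mixed origin, the dilate lies in mu times the
    triangle, whose lattice translates miss the point with both coordinates (1 - mu) / 2. *)
Lemma dilated_mix2_not_covering (R : realType) (lam mu p1 p2 q1 q2 : R)
    (u1 u2 v1 v2 : int) (F1 F2 : R -> R -> Prop) :
  (u1 * v2 - u2 * v1) * (u1 * v2 - u2 * v1) = 1 ->
  hexagonal (in_basis F1 p1 p2 u1 u2 v1 v2) ->
  hexagonal (in_basis F2 q1 q2 u1 u2 v1 v2) -> 0 <= lam <= 1 -> 0 <= mu < 1 ->
  exists x y, forall (m n : int) a b, mix2 lam F1 F2 a b ->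
    x - m%:~R = mu * a -> y - n%:~R = mu * b -> False.
Proof.
move=> dd [_ H1 _] [_ H2 _] hlam hmu.
have ddR : ((u1%:~R * v2%:~R - u2%:~R * v1%:~R) *
    (u1%:~R * v2%:~R - u2%:~R * v1%:~R) : R) = 1.
  by rewrite -!intrM -intrB -intrM dd.
pose c : R := (1 - mu) / 2.
exists (mu * ((1 - lam) * p1 + lam * q1) + (c * u1%:~R + c * v1%:~R)).
exists (mu * ((1 - lam) * p2 + lam * q2) + (c * u2%:~R + c * v2%:~R)).
move=> m n a b [x [y [x' [y' [h1 h2 -> ->]]]]].
have [k [l [-> ->]]] := basis_coordinates _ u1 u2 v1 v2 m n dd.
have [s [t [es et]]] := basis_coordinates _ _ _ _ _ (x - p1) (y - p2) ddR.
have [s' [t' [es' et']]] := basis_coordinates _ _ _ _ _ (x' - q1) (y' - q2) ddR.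
have ex : x = p1 + s * u1%:~R + t * v1%:~R by lra.
have ey : y = p2 + s * u2%:~R + t * v2%:~R by lra.
have ex' : x' = q1 + s' * u1%:~R + t' * v1%:~R by lra.
have ey' : y' = q2 + s' * u2%:~R + t' * v2%:~R by lra.
have [i1 i2 i3] : [/\ -1 <= s, -1 <= t & s + t <= 0].
  by apply: H1; rewrite /in_basis -ex -ey.
have [j1 j2 j3] : [/\ -1 <= s', -1 <= t' & s' + t' <= 0].
  by apply: H2; rewrite /in_basis -ex' -ey'.
rewrite !rmorphD !rmorphM /= => e1 e2.
(* A and B are the coordinates in u, v of a vector that vanishes, so independence of u and v makes
   them 0. *)
set A := c - k%:~R - mu * ((1 - lam) * s + lam * s').
set B := c - l%:~R - mu * ((1 - lam) * t + lam * t').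
have E1 : A * u1%:~R + B * v1%:~R = 0.
  by move: e1; rewrite /A /B ex ex'; lra.
have E2 : A * u2%:~R + B * v2%:~R = 0.
  by move: e2; rewrite /A /B ey ey'; lra.
have A0 : A = 0.
  rewrite -[A]mul1r -ddR (_ : _ * A = (u1%:~R * v2%:~R - u2%:~R * v1%:~R) *
    ((A * u1%:~R + B * v1%:~R) * v2%:~R - (A * u2%:~R + B * v2%:~R) * v1%:~R)); last by ring.
  by rewrite E1 E2 !mul0r subrr mulr0.
have B0 : B = 0.
  rewrite -[B]mul1r -ddR (_ : _ * B = (u1%:~R * v2%:~R - u2%:~R * v1%:~R) *
    ((A * u2%:~R + B * v2%:~R) * u1%:~R - (A * u1%:~R + B * v1%:~R) * u2%:~R)); last by ring.
  by rewrite E1 E2 !mul0r subrr mulr0.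
apply: (shrunk_triangle_misses _ mu ((1 - lam) * s + lam * s')
  ((1 - lam) * t + lam * t') k l) => //; try by nra.
- by move: A0; rewrite /A /c; lra.
- by move: B0; rewrite /B /c; lra.
Qed.

(** * Transfer between row vectors and coordinates *)

Definition row2 {R : realType} (x y : R) : 'rV[R]_2 :=
  \row_(j < 2) (if j == 0 then x else y).

Lemma row2_eta (R : realType) (w : 'rV[R]_2) : w = row2 (w 0 0) (w 0 1).
Proof.
by apply/rowP => j; rewrite mxE; case: ifPn => [/eqP -> //|]; case: j => [[|[|]]] //= h _;
  congr (w _ _); apply/val_inj.
Qed.

Lemma row2D (R : realType) (x y x' y' : R) :
  row2 x y + row2 x' y' = row2 (x + x') (y + y').
Proof. by apply/rowP => j; rewrite !mxE; case: ifP. Qed.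

Lemma row2Z (R : realType) (c x y : R) : c *: row2 x y = row2 (c * x) (c * y).
Proof. by apply/rowP => j; rewrite !mxE; case: ifP. Qed.

Lemma row2N (R : realType) (x y : R) : - row2 x y = row2 (- x) (- y).
Proof. by apply/rowP => j; rewrite !mxE; case: ifP. Qed.

Lemma row2_inj (R : realType) (x y x' y' : R) :
  row2 x y = row2 x' y' -> x = x' /\ y = y'.
Proof.
by move=> e; split; [have := congr1 (fun w : 'rV_2 => w 0 0) e |
  have := congr1 (fun w : 'rV_2 => w 0 1) e]; rewrite !mxE.
Qed.

Lemma Z2_row2 (R : realType) (w : 'rV[R]_2) :
  Z2 R w <-> exists m n : int, w = row2 m%:~R n%:~R.
Proof.
split=> [[z _ <-]|[m [n ->]]].
  by exists (z 0 0), (z 0 1); rewrite [LHS]row2_eta !mxE.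
by exists (\row_(j < 2) (if j == 0 then m else n)) => //; apply/rowP => j; rewrite !mxE; case: ifP.
Qed.

Lemma covering_row2 (R : realType) (K : set 'rV[R]_2) :
  covering K <-> covering2 (fun x y => K (row2 x y)).
Proof.
split=> [cK x y|cK].
  have : minkowski_sum K (Z2 R) (row2 x y) by rewrite cK.
  move=> [a Ka [b /Z2_row2[m [n ->]] e]]; exists m, n.
  move/(canRL (addrK _)): e => e; move: Ka; rewrite e row2N row2D.
  by [].
apply/seteqP; split=> // w _; rewrite [w]row2_eta.
have [m [n Kmn]] := cK (w 0 0) (w 0 1).
exists (row2 (w 0 0 - m%:~R) (w 0 1 - n%:~R)) => //.
exists (row2 m%:~R n%:~R); first by apply/Z2_row2; exists m, n.
by rewrite row2D !subrK.
Qed.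

Lemma row2_continuous (R : realType) : continuous (fun s : R * R => row2 s.1 s.2).
Proof.
move=> s A [P hP sPA]; apply: (filterS sPA).
pose entry (ij : 'I_1 * 'I_2) (t : R * R) := P ij.1 ij.2 (row2 t.1 t.2 ij.1 ij.2).
have : \forall t \near nbhs s, forall ij, entry ij t.
  apply: (filter_forall (nbhs_filter _)) => -[i j].
  have := hP i j; rewrite mxE; case: ifP => j0.
    move=> h; have h1 : \forall t \near nbhs s, P i j t.1 by exact: (cvg_fst h).
    by apply: filterS h1 => t; rewrite /entry mxE j0.
  move=> h; have h2 : \forall t \near nbhs s, P i j t.2 by exact: (cvg_snd h).
  by apply: filterS h2 => t; rewrite /entry mxE j0.
by apply: filterS => t h i j; exact: (h (i, j)).
Qed.

Lemma convex_tile_row2 (R : realType) (Q : set 'rV[R]_2) : convex_tile Q ->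
  [/\ lattice_tile (fun x y => Q (row2 x y)), packing2 (fun x y => Q (row2 x y)) &
    exists M, forall x y, Q (row2 x y) -> `|x| <= M /\ `|y| <= M].
Proof.
move=> [[_ kQ cQ] vQ tQ].
have cF : convex2 (fun x y => Q (row2 x y)).
  move=> x y x' y' t Qx Qy /andP[t0 t1].
  (* The abstract convex combination puts the weight t on its first argument, hence the exchanged
     endpoints. *)
  have := cQ _ _ (Itv01 t0 t1) (mem_set Qy) (mem_set Qx).
  rewrite inE => h.
  have : Q (t *: row2 x' y' + (1 - t) *: row2 x y) := h.
  by rewrite !row2Z row2D addrC [X in row2 _ X]addrC.
have vF : covering2 (fun x y => Q (row2 x y)) by exact/covering_row2.
have kF : closed2 (fun x y => Q (row2 x y)).
  have : closed Q by apply: compact_closed => //; exact: norm_hausdorff.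
  by apply: preimage_closed => s _; exact: row2_continuous.
have pF : packing2 (fun x y => Q (row2 x y)).
  move=> m n c1 c2 e e0 b0 bz.
  have near_c z : (forall x y, `|x - c1| < e -> `|y - c2| < e ->
      translate Q z (row2 x y)) -> interior (translate Q z) (row2 c1 c2).
    move=> h; apply/nbhs_ballP; exists e => //= w hw.
    rewrite [w]row2_eta; apply: h.
      by have := hw.2 0 0; rewrite !mxE /ball /= distrC.
    by have := hw.2 0 1; rewrite !mxE /ball /= distrC.
  pose z : 'rV[int]_2 := \row_(j < 2) (if j == 0 then m else n).
  have ez : map_mx intr z = row2 m%:~R n%:~R :> 'rV[R]_2.
    by apply/rowP => j; rewrite !mxE; case: ifP.
  have z0 : z = 0.
    (* The centre of the common box is interior to the translates by z and by 0. *)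
    apply: tQ => //; exists (row2 c1 c2); split; apply: near_c => x y hx hy.
      exists (row2 (x - m%:~R) (y - n%:~R)); first exact: bz.
      by rewrite ez row2D !subrK.
    exists (row2 x y); first exact: b0.
    by rewrite map_mx0 addr0.
  by split; [have := congr1 (fun w : 'rV_2 => w 0 0) z0 |
    have := congr1 (fun w : 'rV_2 => w 0 1) z0]; rewrite !mxE.
split=> //; first by split=> //; exact: packing2_no_stretched.
have [M [_ hM]] := compact_bounded kQ.
(* Boundedness gives the estimate for constants strictly above M. *)
exists (M + 1) => x y Qxy.
have le_norm (j : 'I_2) : `|row2 x y 0 j| <= M + 1.
  apply: le_trans (hM (M + 1) _ _ Qxy); last by rewrite ltrDl.
  rewrite [leRHS]/Num.norm /= mx_normrE.
  exact: (le_bigmax _ (fun i : 'I_1 * 'I_2 => `|row2 x y i.1 i.2|) (0, j)).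
by split; [have := le_norm 0 | have := le_norm 1]; rewrite mxE.
Qed.

Theorem theorem1p3 (R : realType) (Q1 Q2 : set 'rV[R]_2)
    (hQ1 : convex_tile Q1) (hQ2 : convex_tile Q2)
    (hQ12 : minkowski_diff Q1 Q1 `&` Z2 R `<=` minkowski_diff Q2 Q2 `&` Z2 R) :
  (forall lam : R, 0 <= lam <= 1 ->
     minkowski_sum (minkowski_sum (dilate (1 - lam) Q1) (dilate lam Q2)) (Z2 R) = setT) /\
  (forall lam mu : R, 0 <= lam <= 1 -> 0 <= mu < 1 ->
     ~ covering (dilate mu (minkowski_sum (dilate (1 - lam) Q1) (dilate lam Q2)))).
Proof.
have [t1 k1 [M1 b1]] := convex_tile_row2 _ _ hQ1.
have [t2 k2 [M2 b2]] := convex_tile_row2 _ _ hQ2.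
have F12 (m n : int) : diff2 (fun x y => Q1 (row2 x y)) m%:~R n%:~R ->
    diff2 (fun x y => Q2 (row2 x y)) m%:~R n%:~R.
  move=> [a [b [a' [b' [h1 h2 e1 e2]]]]].
  have [|[c Qc [c' Qc' e]] _] := hQ12 (row2 m%:~R n%:~R).
    split; last by apply/Z2_row2; exists m, n.
    exists (row2 a b) => //; exists (row2 a' b') => //.
    by rewrite row2N row2D -e1 -e2.
  exists (c 0 0), (c 0 1), (c' 0 0), (c' 0 1); rewrite -!row2_eta.
  have := e; rewrite {1}[c]row2_eta {1}[c']row2_eta row2N row2D.
  by move=> /row2_inj[<- <-].
have [u1 [u2 [v1 [v2 [dd [p1 [p2 [q1 [q2 [H1 H2]]]]]]]]]] :=
  common_hexagonal_basis _ _ _ _ _ t1 k1 b1 t2 k2 b2 F12.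
have mixE lam x y : minkowski_sum (dilate (1 - lam) Q1) (dilate lam Q2) (row2 x y) <->
    mix2 lam (fun x y => Q1 (row2 x y)) (fun x y => Q2 (row2 x y)) x y.
  split=> [[_ [a Qa <-] [_ [b Qb <-] e]]|[a [b [a' [b' [h1 h2 -> ->]]]]]].
    exists (a 0 0), (a 0 1), (b 0 0), (b 0 1); rewrite -!row2_eta.
    have := e; rewrite {1}[a]row2_eta {1}[b]row2_eta !row2Z row2D.
    by move=> /row2_inj[<- <-].
  exists ((1 - lam) *: row2 a b); first by exists (row2 a b).
  exists (lam *: row2 a' b'); first by exists (row2 a' b').
  by rewrite !row2Z row2D.
split=> [lam hlam|lam mu hlam hmu /covering_row2 cK].
  apply/covering_row2 => x y.
  have [m [n h]] := mix2_covers _ _ _ _ _ _ _ _ _ _ _ _ dd t1 t2 H1 H2 hlam x y.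
  by exists m, n; apply/mixE.
have [x [y hxy]] := dilated_mix2_not_covering _ _ _ _ _ _ _ _ _ _ _ _ _ dd H1 H2 hlam hmu.
have [m [n [w Kw e]]] := cK x y.
move: Kw e; rewrite [w]row2_eta row2Z => /mixE Kw /row2_inj[e1 e2].
exact: hxy Kw (esym e1) (esym e2).
Qed.
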